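(* Suppose the following conditions hold for both $j=1,2$: 1. $f_0(z)$ and $f_j(z)$ are twice continuously differentiable. 2. There exists a constant $\alpha$ such that the sublevel sets $\{z\in\mathbb R^d: f_0(z)+t(f_j(z)-f_0(z))\le\alpha\}$ are nonempty and uniformly bounded for $t\in[0,1]$. 3. For every $t\in[0,1]$, the function $f_0(z)+t(f_j(z)-f_0(z))$ has a unique minimizer over $\mathbb R^d$, and its Hessian $\nabla^2\big(f_0(z)+t(f_j(z)-f_0(z))\big)$ is positive definite at this unique minimizer. Denote the minimizer for $t=0$ by $z_0$. 4. $\mathbb E[c(z;Y)\mid X=x]$ is twice Lipschitz-continuously differentiable in $x$. Then $$\big|\mathcal C^{\text{oracle}}(R_1,R_2)-\mathcal C^{\text{apx-soln}}(R_1,R_2)\big|=o(\mathcal D_0^2)$$ as $\mathcal D_0\to0$, where $\mathcal D_0=\sup_{x,x'\in R_0}\|x-x'\|_2$ is the diameter of $R_0$.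
   Context: $(X,Y)$ is a random pair with $X$ taking values in $\mathbb R^p$ and $Y$ in a set $\mathcal Y$; $c(z;y)$ is a real-valued cost function of a decision $z\in\mathbb R^d$ (unconstrained) and $y\in\mathcal Y$. $R_0\subseteq\mathbb R^p$ is a region with a candidate subpartition $R_0=R_1\cup R_2$, $R_1\cap R_2=\varnothing$. For $j=0,1,2$: $p_j=\mathbb P(X\in R_j)$ and $f_j(z)=\mathbb E[c(z;Y)\mid X\in R_j]$. The oracle splitting criterion is $$\mathcal C^{\text{oracle}}(R_1,R_2)=\sum_{j=1,2}\min_{z\in\mathbb R^d}\mathbb E\big[c(z;Y)\mathbb I[X\in R_j]\big]=\sum_{j=1,2}p_j\min_{z\in\mathbb R^d}f_j(z),$$ and the approximate solution criterion is $$\mathcal C^{\text{apx-soln}}(R_1,R_2)=\sum_{j=1,2}p_j\,f_j\Big(z_0-\big(\nabla^2f_0(z_0)\big)^{-1}\nabla f_j(z_0)\Big).$$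
   Formalization: Regions vary in a bounded set; added uniformly in the regions: the bound in condition 2 and a positive lower bound on the Hessian of f_0 at z_0; E[c(z;Y)|X=x] is also C^2 in z with Hessian continuous in (z,x), and condition 4's Lipschitz constant is locally uniform in z. *)

(* Defs.v *)
From mathcomp Require Import all_boot all_order all_algebra.
From mathcomp Require Import all_classical all_reals all_analysis.

Set Implicit Arguments.
Unset Strict Implicit.
Unset Printing Implicit Defensive.

Import Order.TTheory GRing.Theory Num.Theory.
Import numFieldNormedType.Exports.

Local Open Scope classical_set_scope.
Local Open Scope ring_scope.

(* The library norm `|v| on matrices is the max norm. *)
Definition l2norm (R : realType) (n : nat) (v : 'cV[R]_n) : R :=
  Num.sqrt (\sum_i v i 0 ^+ 2).

(* Only meaningful for bounded A: sup is 0 on sets with no upper bound. *)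
Definition diameter (R : realType) (n : nat) (A : set 'cV[R]_n) : R :=
  sup [set l2norm (xy.1 - xy.2) | xy in A `*` A].

Definition partial (R : realType) (n : nat) (i : 'I_n) (f : 'cV[R]_n -> R)
  (z : 'cV[R]_n) : R := 'D_(delta_mx i 0) (f : _ -> R^o) z.

Definition grad (R : realType) (n : nat) (f : 'cV[R]_n -> R)
  (z : 'cV[R]_n) : 'cV[R]_n := \col_i partial i f z.

Definition hess (R : realType) (n : nat) (f : 'cV[R]_n -> R)
  (z : 'cV[R]_n) : 'M[R]_n := \matrix_(i, j) partial j (partial i f) z.

Definition twice_continuously_differentiable (R : realType) (n : nat)
    (f : 'cV[R]_n -> R) : Prop :=
  [/\ forall z, differentiable (f : _ -> R^o) z,
      forall i z, differentiable (partial i f : _ -> R^o) z &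
      continuous (hess f)].

Definition quadform (R : realType) (n : nat) (H : 'M[R]_n) (v : 'cV[R]_n) : R :=
  (v^T *m H *m v) 0 0.

Definition positive_definite (R : realType) (n : nat) (H : 'M[R]_n) : Prop :=
  forall v : 'cV[R]_n, v != 0 -> 0 < quadform H v.

Definition is_minimizer (R : realType) (n : nat) (f : 'cV[R]_n -> R)
  (z : 'cV[R]_n) : Prop := forall z', f z <= f z'.

Definition is_unique_minimizer (R : realType) (n : nat) (f : 'cV[R]_n -> R)
    (z : 'cV[R]_n) : Prop :=
  is_minimizer f z /\ forall z', is_minimizer f z' -> z' = z.

Definition interpolate (R : realType) (n : nat) (f0 f1 : 'cV[R]_n -> R) (t : R)
  (z : 'cV[R]_n) : R := f0 z + t * (f1 z - f0 z).

(* B bounds the sublevel sets simultaneously for all t; the level alpha is free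
   to depend on (f0, f1). *)
Definition inf_compact (R : realType) (n : nat) (B : R)
    (f0 f1 : 'cV[R]_n -> R) : Prop :=
  exists alpha : R, forall t : R, 0 <= t <= 1 ->
    (exists z, interpolate f0 f1 t z <= alpha) /\
    (forall z, interpolate f0 f1 t z <= alpha -> l2norm z <= B).

Definition unique_nondegenerate_minimizers (R : realType) (n : nat)
    (f0 f1 : 'cV[R]_n -> R) : Prop :=
  forall t : R, 0 <= t <= 1 ->
    exists z, is_unique_minimizer (interpolate f0 f1 t) z /\
              positive_definite (hess (interpolate f0 f1 t) z).

Definition borel (R : realType) (n : nat) : set (set 'cV[R]_n) :=
  <<s [set U : set 'cV[R]_n | open U] >>.

Definition borel_measurable (R : realType) (n : nat) (f : 'cV[R]_n -> R) : Prop :=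
  forall B : set R, measurable B -> borel (f @^-1` B).

Definition random_vector (R : realType) (d : measure_display)
    (Omega : measurableType d) (n : nat) (X : Omega -> 'cV[R]_n) : Prop :=
  forall A, borel A -> measurable (X @^-1` A).

Section Criteria.
Context (R : realType) (dO : measure_display) (Omega : measurableType dO).
Context (P : probability Omega R) (p d : nat) (YT : Type).
Context (c : 'cV[R]_d -> YT -> R) (X : Omega -> 'cV[R]_p) (Y : Omega -> YT).

Definition region_prob (A : set 'cV[R]_p) : R := fine (P (X @^-1` A)).

Definition region_expectation (U : Omega -> R) (A : set 'cV[R]_p) : R :=
  fine 'E_P[fun w => U w * \1_(X @^-1` A) w].

Definition cond_cost (A : set 'cV[R]_p) (z : 'cV[R]_d) : R :=
  region_expectation (fun w => c z (Y w)) A / region_prob A.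

(* m z x is a version of E[c(z;Y) | X = x]. *)
Definition is_cond_cost_given_X (m : 'cV[R]_d -> 'cV[R]_p -> R) : Prop :=
  forall z, [/\ borel_measurable (m z),
    P.-integrable setT (fun w => (m z (X w))%:E) &
    forall A, borel A -> region_expectation (fun w => m z (X w)) A =
                         region_expectation (fun w => c z (Y w)) A].

(* The infimum of a range is a minimum whenever one is attained. *)
Definition oracle_term (A : set 'cV[R]_p) : R :=
  inf (range (fun z => region_expectation (fun w => c z (Y w)) A)).

Definition criterion_oracle (R1 R2 : set 'cV[R]_p) : R :=
  oracle_term R1 + oracle_term R2.

Definition apx_soln_term (R0 A : set 'cV[R]_p) (z0 : 'cV[R]_d) : R :=
  region_prob A *
  cond_cost A (z0 - invmx (hess (cond_cost R0) z0) *m grad (cond_cost A) z0).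

(* z0 stands for the minimizer of cond_cost (R1 `|` R2). *)
Definition criterion_apx_soln (R1 R2 : set 'cV[R]_p) (z0 : 'cV[R]_d) : R :=
  apx_soln_term (R1 `|` R2) R1 z0 + apx_soln_term (R1 `|` R2) R2 z0.

End Criteria.

(* C^{2,1} in x for each z, with Lipschitz constant of the second derivative
   locally uniform in z. *)
Definition twice_lipschitz_differentiable_in_x (R : realType) (d p : nat)
    (m : 'cV[R]_d -> 'cV[R]_p -> R) : Prop :=
  (forall z, twice_continuously_differentiable (m z)) /\
  forall B : R, exists L : R, forall z, l2norm z <= B ->
    forall x x', `|hess (m z) x - hess (m z) x'| <= L * l2norm (x - x').

(* The pointwise (in x) counterpart of C^2 smoothness of the regional costs,
   with second derivative in z depending continuously on (z, x). *)
Definition twice_differentiable_in_z (R : realType) (d p : nat)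
    (m : 'cV[R]_d -> 'cV[R]_p -> R) : Prop :=
  (forall x, twice_continuously_differentiable (m ^~ x)) /\
  continuous (fun zx : 'cV[R]_d * 'cV[R]_p => hess (m ^~ zx.2) zx.1).

(* Main.v *)
Require Import Defs.
From mathcomp Require Import all_boot all_order all_algebra.
From mathcomp Require Import all_classical all_reals all_analysis.
From mathcomp Require Import ring lra.
Import Order.TTheory GRing.Theory Num.Theory.
Import numFieldNormedType.Exports.
Local Open Scope classical_set_scope.
Local Open Scope ring_scope.

Set Implicit Arguments.
Unset Strict Implicit.
Unset Printing Implicit Defensive.

(** Fix one subregion, with cost f_j, and write f_0 for the cost of the whole
    region, D for its diameter, g for the gradient of f_j at z0 and H for the
    Hessian of f_0 at z0.  Both costs are averages of m(., x) over x in the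
    region, and this gives two estimates, uniform over all regions in a bounded
    set.

    - The Hessians of f_0 and f_j differ from H by o(1) near z0, because the
      Hessian of m in z is uniformly continuous on compact sets.  Hence f_j is,
      up to o(1) |s|^2, the quadratic model f_j(z0) + g.s + s.Hs / 2 at z0 + s.

    - The gradient g is O(D), because the gradient of m in z is Lipschitz in x
      ([jets_grad_lipschitz]) and f_0 has gradient 0 at z0.  The Lipschitz bound
      on this mixed quantity is an interpolation between three derivatives in x
      (a Lipschitz Hessian) and two in z ([quadratic_approx_lipschitz_at0]).

    The approximate solution is the exact minimizer of the quadratic model, at
    distance O(|g|) = O(D) from z0, so the model error there is o(D^2).  By
    uniform positive definiteness of H, the true minimizer of f_j cannot profit
    more than that from the model error, if it lies in the ball around z0 where
    the model is valid ([newton_step_gap]).  That it lies there is a global fact: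
    along t in [0, 1] the minimizer of f_0 + t (f_j - f_0) starts at z0, and once
    in the ball it is in the half ball ([near_minimizer_nearer]), so by
    uniqueness and compactness it cannot leave ([minimizer_path_stays_near]).
    [region_gap] combines these facts, and the theorem adds up two subregions
    with weights at most 1.

    Derivatives are never taken under the integral sign: bounds on finite
    differences of m pass to averages ([is_mean]) and then to the derivatives
    of the averages. *)

(** * Norms, quadratic forms and compactness *)

Lemma entry_le_norm (R : realType) (m n : nat) (A : 'M[R]_(m, n)) i j :
  `|A i j| <= `|A|.
Proof.
rewrite [leRHS]/Num.norm /= mx_normrE; apply/bigmax_geP; right => /=.
by exists (i, j).
Qed.

Lemma norm_le_entries (R : realType) (m n : nat) (A : 'M[R]_(m, n)) (e : R) :
  0 <= e -> (forall i j, `|A i j| <= e) -> `|A| <= e.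
Proof.
move=> e0 he; rewrite /Num.norm /= mx_normrE; by apply/bigmax_leP; split => // -[i j] _; exact: he.
Qed.

Lemma l2norm_ge0 (R : realType) (n : nat) (v : 'cV[R]_n) : 0 <= l2norm v.
Proof. exact: sqrtr_ge0. Qed.

Lemma sqr_l2norm (R : realType) (n : nat) (v : 'cV[R]_n) :
  l2norm v ^+ 2 = \sum_i v i 0 ^+ 2.
Proof. by rewrite sqr_sqrtr// sumr_ge0// => i _; exact: sqr_ge0. Qed.

Lemma norm_le_l2norm (R : realType) (n : nat) (v : 'cV[R]_n) :
  `|v| <= l2norm v.
Proof.
apply: norm_le_entries (l2norm_ge0 _) _ => i j; rewrite (ord1 j).
rewrite -ler_sqr ?nnegrE ?l2norm_ge0// sqr_l2norm (bigD1 i)//= -normrX ger0_norm ?sqr_ge0//.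
by rewrite lerDl sumr_ge0// => k _; exact: sqr_ge0.
Qed.

Lemma l2norm_le_norm (R : realType) (n : nat) (v : 'cV[R]_n) :
  l2norm v <= n%:R * `|v|.
Proof.
have n0 : 0 <= n%:R * `|v| by exact: mulr_ge0.
rewrite -ler_sqr ?nnegrE ?l2norm_ge0// sqr_l2norm.
apply: (@le_trans _ _ (\sum_(i < n) `|v| ^+ 2)).
  apply: ler_sum => i _; rewrite -[leLHS]ger0_norm ?sqr_ge0// normrX.
  by rewrite ler_sqr ?nnegrE//; exact: entry_le_norm.
rewrite sumr_const card_ord exprMn -[leLHS]mulr_natl; apply: ler_wpM2r; first exact: sqr_ge0.
by rewrite -natrX ler_nat; case: n {v n0} => // n; rewrite leq_pmulr.
Qed.

Lemma quadformE (R : realType) (n : nat) (H : 'M[R]_n) (v : 'cV[R]_n) :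
  quadform H v = \sum_i \sum_j v i 0 * H i j * v j 0.
Proof.
rewrite /quadform mxE exchange_big /=; apply: eq_bigr => j _.
by rewrite !mxE big_distrl /=; apply: eq_bigr => i _; rewrite !mxE.
Qed.

Lemma quadformB (R : realType) (n : nat) (H K : 'M[R]_n) (v : 'cV[R]_n) :
  quadform (H - K) v = quadform H v - quadform K v.
Proof. by rewrite /quadform mulmxBr mulmxBl !mxE. Qed.

Lemma quadformZ (R : realType) (n : nat) (H : 'M[R]_n) (h : R) (v : 'cV[R]_n) :
  quadform H (h *: v) = h ^+ 2 * quadform H v.
Proof.
by rewrite /quadform -scalemxAr [(h *: v)^T]linearZ /= -!scalemxAl scalerA !mxE expr2.
Qed.

Lemma quadform_le (R : realType) (n : nat) (H : 'M[R]_n) (v : 'cV[R]_n) :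
  `|quadform H v| <= n%:R ^+ 2 * `|H| * `|v| ^+ 2.
Proof.
rewrite quadformE; apply: le_trans (ler_norm_sum _ _ _) _.
apply: (@le_trans _ _ (\sum_(i < n) \sum_(j < n) `|H| * `|v| ^+ 2)); last first.
  by rewrite !sumr_const !card_ord -mulrnA -[leLHS]mulr_natl natrM expr2 mulrA.
apply: ler_sum => i _; apply: le_trans (ler_norm_sum _ _ _) _.
apply: ler_sum => j _; rewrite !normrM mulrAC -mulrA (mulrC `|H|) expr2 mulrA.
apply: ler_pM => //; last exact: entry_le_norm.
by rewrite ler_pM//; exact: entry_le_norm.
Qed.

(** Transposition reduces to row vectors, whose bounded closed sets are compact. *)
Lemma compact_cV_ball (R : realType) (n : nat) (B : R) :
  compact [set z : 'cV[R]_n | `|z| <= B].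
Proof.
have cT : compact [set z : 'rV[R]_n | `|z| <= B].
  apply: bounded_closed_compact.
    by exists B; split => [|x Bx z /= zB]; [exact: num_real|rewrite (le_trans zB)// ltW].
  rewrite (_ : [set z | _] = Num.norm @^-1` [set x : R | x <= B])//.
  by apply: closed_comp (@closed_le _ B) => x _; exact: norm_continuous.
have tr_norm m k (A : 'M[R]_(m, k)) : `|A^T| <= `|A|.
  by apply: norm_le_entries => // i j; rewrite mxE; exact: entry_le_norm.
have ct : continuous (@trmx R 1 n).
  move=> z A /nbhs_ballP[e /= e0 eA]; apply/nbhs_ballP; exists e => //= w zw.
  apply: eA; move: zw; rewrite -!ball_normE /= -linearB /=; apply: le_lt_trans.
  exact: tr_norm.
suff -> : [set z : 'cV[R]_n | `|z| <= B] = @trmx R 1 n @` [set z : 'rV[R]_n | `|z| <= B].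
  by apply: continuous_compact cT; exact: continuous_subspaceT.
apply/seteqP; split => [z /= zB|_ [z /= zB <-] /=]; last exact: le_trans (tr_norm _ _ _) zB.
by exists z^T; [exact: le_trans (tr_norm _ _ _) zB|rewrite trmxK].
Unshelve. all: by end_near. Qed.

Lemma compact_unif_continuous (R : realType) (U V : normedModType R)
    (K : set U) (g : U -> V) (e : R) : compact K -> continuous g -> 0 < e ->
  exists2 r : R, 0 < r & forall u u', K u -> `|u - u'| < r -> `|g u - g u'| < e.
Proof.
move=> /compact_near_coveringP cK cg e0.
have e20 : 0 < e / 2 by rewrite divr_gt0.
have := cK R ((0:R)^'+) (fun r u => forall u', `|u - u'| < r -> `|g u - g u'| < e) _.
case=> [u Ku|r /= r0 Hr].
  have /cvgrPdist_lt/(_ _ e20)/nbhs_ballP[r /= r0 Hr] := cg u.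
  exists (ball u (r / 2), [set s | s < r / 2]); first split => /=.
  - by apply: nbhsx_ballx; rewrite divr_gt0.
  - by exists (r / 2) => /=; [rewrite divr_gt0|move=> s /=; rewrite sub0r normrN => /ltr_normlW].
  move=> [v s] /= [uv sr] w vw.
  rewrite (splitr e) (le_lt_trans (ler_distD (g u) _ _))//.
  move: uv; rewrite -ball_normE /= => uv.
  rewrite ltrD//; first (rewrite distrC; apply: Hr); last apply: Hr; rewrite -ball_normE /=.
    by rewrite (lt_trans uv)// ltr_pdivrMr// ltr_pMr// ltr1n.
  rewrite (splitr r) (le_lt_trans (ler_distD v _ _))// ltrD//.
  exact: lt_trans sr.
exists (r / 2); first by rewrite divr_gt0.
have r2 : r / 2 < r by rewrite ltr_pdivrMr// ltr_pMr// ltr1n.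
move=> u u' Ku uu'; apply: (Hr (r / 2) _ _ u Ku u' uu'); last by rewrite divr_gt0.
by rewrite /= sub0r normrN gtr0_norm// divr_gt0.
Qed.

Lemma compact_norm_bounded (R : realType) (U V : normedModType R)
    (K : set U) (g : U -> V) : compact K -> continuous g ->
  exists2 C : R, 0 < C & forall u, K u -> `|g u| <= C.
Proof.
move=> cK cg.
have : compact (g @` K) by apply: continuous_compact cK; exact: continuous_subspaceT.
move=> /compact_bounded[C [_ HC]].
exists (`|C| + 1); first by rewrite ltr_wpDl.
move=> u Ku; apply: (HC (`|C| + 1)); last by exists u.
by rewrite (le_lt_trans (ler_norm C))// ltrDl.
Qed.

Lemma gradE (R : realType) (n : nat) (f : 'cV[R]_n -> R) z i :
  grad f z i 0 = partial i f z.
Proof. by rewrite mxE. Qed.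

Lemma hessE (R : realType) (n : nat) (f : 'cV[R]_n -> R) z i j :
  hess f z i j = partial j (partial i f) z.
Proof. by rewrite mxE. Qed.

Lemma derive_delta (R : realType) (n : nat) (f : 'cV[R]_n -> R) z i :
  'D_(delta_mx i 0) (f : _ -> R^o) z = partial i f z.
Proof. by []. Qed.

(** * Second-order Taylor estimates along lines *)

Definition dot (R : realType) (n : nat) (u v : 'cV[R]_n) : R := (u^T *m v) 0 0.

Lemma dotE (R : realType) (n : nat) (u v : 'cV[R]_n) :
  dot u v = \sum_i u i 0 * v i 0.
Proof. by rewrite /dot mxE; apply: eq_bigr => i _; rewrite mxE. Qed.

Lemma norm_delta_mx (R : realType) (n : nat) (i : 'I_n) :
  `|delta_mx i 0 : 'cV[R]_n| <= 1.
Proof.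
apply: norm_le_entries => // a b; rewrite mxE; case: (_ && _) => /=.
  by rewrite normr1.
by rewrite normr0.
Qed.

Lemma dot_delta_mx (R : realType) (n : nat) (u : 'cV[R]_n) (i : 'I_n) :
  dot u (delta_mx i 0) = u i 0.
Proof.
rewrite dotE (bigD1 i)//= big1 ?addr0 => [|j /negbTE ji].
  by rewrite mxE !eqxx mulr1.
by rewrite mxE ji mulr0.
Qed.

Lemma derive_grad (R : realType) (n : nat) (f : 'cV[R]_n -> R) (z v : 'cV[R]_n) :
  differentiable (f : _ -> R^o) z -> 'D_v (f : _ -> R^o) z = dot (grad f z) v.
Proof.
move=> df; rewrite deriveE// dotE {1}(matrix_sum_delta v) linear_sum /=.
apply: eq_bigr => i _; rewrite big_ord1 linearZ /= gradE -derive_delta deriveE//.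
by rewrite mulrC.
Qed.

Lemma is_derive_line (R : realType) (n : nat) (f : 'cV[R]_n -> R)
    (z v : 'cV[R]_n) (s : R) :
  differentiable (f : _ -> R^o) (z + s *: v) ->
  is_derive s 1 (fun t => f (z + t *: v)) (dot (grad f (z + s *: v)) v).
Proof.
move=> df; rewrite -derive_grad//.
have E : (fun h : R => h^-1 *: (((fun t => f (z + t *: v)) \o shift s) (h *: (1 : R))
       - f (z + s *: v)))
   = (fun h : R => h^-1 *: (((f : _ -> R^o) \o shift (z + s *: v)) (h *: v) - f (z + s *: v))).
  apply/funext => h /=; congr (_ *: (f _ - _)).
  by rewrite scalerDl [h *: 1]mulr1 addrCA.
have dv : derivable (f : _ -> R^o) (z + s *: v) v by exact: diff_derivable.
by split; rewrite /derivable /derive E.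
Qed.

(** C^2 regularity as seen along lines.  The gradient g and the Hessian H are
    parameters, so that the same lemmas apply to regional costs and to m in either
    of its two variables. *)
Definition jet2 (R : realType) (n : nat) (f : 'cV[R]_n -> R)
    (g : 'cV[R]_n -> 'cV[R]_n) (H : 'cV[R]_n -> 'M[R]_n) : Prop :=
  [/\ forall z v (s : R),
        is_derive s 1 (fun t => f (z + t *: v)) (dot (g (z + s *: v)) v),
      forall i z v (s : R),
        is_derive s 1 (fun t => g (z + t *: v) i 0) ((H (z + s *: v) *m v) i 0) &
      continuous H].

Lemma jet2_grad_hess (R : realType) (n : nat) (f : 'cV[R]_n -> R) :
  twice_continuously_differentiable f -> jet2 f (grad f) (hess f).
Proof.
move=> [df ddf ch]; split=> // [z v s|i z v s]; first exact: is_derive_line.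
under eq_fun do rewrite gradE.
apply: is_derive_eq (is_derive_line (ddf i (z + s *: v))) _.
by rewrite dotE mxE; apply: eq_bigr => j _; rewrite gradE hessE.
Qed.

Lemma jet2_line2 (R : realType) (n : nat) (f : 'cV[R]_n -> R) g H z v (s : R) :
  jet2 f g H ->
  is_derive s 1 (fun t => dot (g (z + t *: v)) v) (quadform (H (z + s *: v)) v).
Proof.
move=> [_ dg _].
have := @is_derive_sum R R R n (fun i t => v i 0 * g (z + t *: v) i 0) s 1 _
  (fun i => is_deriveZ (v i 0) (dg i z v s)).
rewrite (_ : (\sum_i _) = (fun t => dot (g (z + t *: v)) v)); last first.
  by apply/funext => t; rewrite fct_sumE dotE; apply: eq_bigr => i _; rewrite mulrC.
move=> h; apply: is_derive_eq h _; rewrite quadformE; apply: eq_bigr => i _.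
rewrite mxE [_ *: _]mulr_sumr; apply: eq_bigr => j _.
by rewrite mulrA.
Qed.

Lemma mvt_line (R : realType) (g dg : R -> R) (h : R) : 0 < h ->
  (forall s : R, is_derive s 1 g (dg s)) ->
  exists2 c, 0 < c < h & g h - g 0 = dg c * h.
Proof.
move=> h0 dgE.
have [] := @MVT R g dg 0 h h0 (fun s _ => dgE s).
  apply: continuous_subspaceT => s; apply: differentiable_continuous.
  exact/derivable1_diffP.
by move=> c; rewrite in_itv /= => ch; rewrite subr0; exists c.
Qed.

(** On [0, h], th minus the quadratic upper model is nonincreasing. *)
Lemma taylor2_ub (R : realType) (th th1 th2 : R -> R) (b h : R) :
  (forall s : R, is_derive s 1 th (th1 s)) -> (forall s : R, is_derive s 1 th1 (th2 s)) ->
  0 < h -> (forall s : R, 0 <= s <= h -> th2 s <= b) ->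
  th h <= th 0 + h * th1 0 + h ^+ 2 / 2 * b.
Proof.
move=> d1 d2 h0 le_b.
have dpsi (s : R) : is_derive s 1 (th + (- (th1 0) *: id + - (b / 2) *: id ^+ 2))
    (th1 s + (- (th1 0) - b * s)).
  have di := @is_derive_id R R s 1.
  apply: (is_derive_eq (is_deriveD (d1 s) (is_deriveD (is_deriveZ (- (th1 0)) di)
    (is_deriveZ (- (b / 2)) (is_deriveX 2 di))))).
  by rewrite /= expr1 /GRing.scale /=; field.
have [c /andP[c0 ch]] := mvt_line h0 dpsi.
rewrite !fctE /GRing.scale /= => E.
have [e /andP[e0 ec] E1] := mvt_line c0 d2.
have he : th2 e <= b by apply: le_b; rewrite (ltW e0) (ltW (lt_trans ec ch)).
have : (th1 c + (- (th1 0) - b * c)) * h <= 0.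
  rewrite pmulr_lle0//; have : th2 e * c <= b * c by rewrite ler_pM2r.
  by rewrite -E1; lra.
by rewrite -E !expr2; lra.
Qed.

Lemma taylor2 (R : realType) (th th1 th2 : R -> R) (a eta h : R) :
  (forall s : R, is_derive s 1 th (th1 s)) -> (forall s : R, is_derive s 1 th1 (th2 s)) ->
  0 < h -> (forall s : R, 0 <= s <= h -> `|th2 s - a| <= eta) ->
  `|th h - th 0 - h * th1 0 - h ^+ 2 / 2 * a| <= h ^+ 2 / 2 * eta.
Proof.
move=> d1 d2 h0 le_eta; have := taylor2_ub (b := a + eta) d1 d2 h0.
have d1N (s : R) : is_derive s 1 (fun t => - th t) (- th1 s) by apply: is_deriveN.
have d2N (s : R) : is_derive s 1 (fun t => - th1 t) (- th2 s) by apply: is_deriveN.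
have := taylor2_ub (b := eta - a) d1N d2N h0.
move=> H1 H2.
have {}H1 : - th h <= - th 0 + h * - th1 0 + h ^+ 2 / 2 * (eta - a).
  by apply: H1 => s /le_eta; rewrite ler_norml => /andP[]; lra.
have {}H2 : th h <= th 0 + h * th1 0 + h ^+ 2 / 2 * (a + eta).
  by apply: H2 => s /le_eta; rewrite ler_norml => /andP[]; lra.
by rewrite ler_norml; apply/andP; split; nra.
Qed.

Lemma taylor2_cV (R : realType) (n : nat) (f : 'cV[R]_n -> R) g H (z v : 'cV[R]_n) (a eta : R) :
  jet2 f g H ->
  (forall s : R, 0 <= s <= 1 -> `|quadform (H (z + s *: v)) v - a| <= eta) ->
  `|f (z + v) - f z - dot (g z) v - a / 2| <= eta / 2.
Proof.
move=> fgH hH; have [df _ _] := fgH.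
have := taylor2 (df z v) (fun s => jet2_line2 z v s fgH) ltr01 hH.
by rewrite scale1r scale0r addr0 expr1n !mul1r mulrC [_^-1 * eta]mulrC.
Qed.

Lemma dotN (R : realType) (n : nat) (u v : 'cV[R]_n) : dot u (- v) = - dot u v.
Proof. by rewrite /dot mulmxN mxE. Qed.

Lemma dotZ (R : realType) (n : nat) (u v : 'cV[R]_n) (h : R) :
  dot u (h *: v) = h * dot u v.
Proof. by rewrite /dot -scalemxAr mxE. Qed.

Lemma quadformN (R : realType) (n : nat) (H : 'M[R]_n) (v : 'cV[R]_n) :
  quadform H (- v) = quadform H v.
Proof. by rewrite -scaleN1r quadformZ sqrrN expr1n mul1r. Qed.

Lemma second_difference (R : realType) (n : nat) (f : 'cV[R]_n -> R) g H
    (z v : 'cV[R]_n) (a eta : R) :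
  jet2 f g H ->
  (forall s, `|s| <= 1 -> `|quadform (H (z + s *: v)) v - a| <= eta) ->
  `|f (z + v) + f (z - v) - 2 * f z - a| <= eta.
Proof.
move=> fgH hH.
have := @taylor2_cV R n f g H z v a eta fgH.
have := @taylor2_cV R n f g H z (- v) a eta fgH.
rewrite dotN => H1 H2.
have {}H1 : `|f (z - v) - f z - - dot (g z) v - a / 2| <= eta / 2.
  apply: H1 => s /andP[s0 s1]; rewrite scalerN -scaleNr quadformN; apply: hH.
  by rewrite normrN ger0_norm.
have {}H2 : `|f (z + v) - f z - dot (g z) v - a / 2| <= eta / 2.
  by apply: H2 => s /andP[s0 s1]; apply: hH; rewrite ger0_norm.
by move: H1 H2; rewrite !ler_norml => /andP[? ?] /andP[? ?]; apply/andP; split; lra.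
Qed.

Lemma hess_quadform_near (R : realType) (n : nat) (f : 'cV[R]_n -> R) g H
    (u v : 'cV[R]_n) (e : R) :
  jet2 f g H -> 0 < e ->
  exists2 r, 0 < r & forall w, `|u - w| < r ->
    `|quadform (H w) v - quadform (H u) v| <= e.
Proof.
move=> [_ _ ch] e0; set k := n%:R ^+ 2 * `|v| ^+ 2 + 1.
have k0 : 0 < k by rewrite ltr_wpDl// mulr_ge0// sqr_ge0.
have [r r0 Hr] := compact_unif_continuous (@compact_set1 _ u) ch (divr_gt0 e0 k0).
exists r => // w uw; have {}Hr := Hr u w erefl uw.
rewrite -quadformB; apply: le_trans (quadform_le _ _) _.
rewrite distrC mulrAC; apply: (@le_trans _ _ (k * (e / k))).
  by apply: ler_pM; rewrite ?mulr_ge0 ?sqr_ge0//; [rewrite lerDl|exact: ltW].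
by rewrite mulrC divfK// gt_eqF.
Qed.

(** The second directional derivative is a limit of second differences, so
    it inherits any bound that they satisfy. *)
Lemma hess_of_second_differences (R : realType) (n : nat) (f : 'cV[R]_n -> R) g H
    (u v : 'cV[R]_n) (a eta rho : R) :
  jet2 f g H -> 0 < rho ->
  (forall h, 0 < h < rho ->
    `|f (u + h *: v) + f (u - h *: v) - 2 * f u - h ^+ 2 * a| <= h ^+ 2 * eta) ->
  `|quadform (H u) v - a| <= eta.
Proof.
move=> fgH rho0 hH; apply/ler_addgt0Pr => e e0.
have [r r0 Hr] := hess_quadform_near u v fgH e0.
have v1 : 0 < `|v| + 1 by rewrite ltr_wpDl.
pose h := Num.min (rho / 2) (r / 2 / (`|v| + 1)).
have h0 : 0 < h by rewrite lt_min !divr_gt0.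
have hrho : h < rho by rewrite gt_min; apply/orP; left; lra.
have hv : h * `|v| < r.
  apply: (@le_lt_trans _ _ (h * (`|v| + 1))); first by rewrite ler_pM2l// lerDl.
  apply: (@le_lt_trans _ _ (r / 2)); last lra.
  by rewrite -ler_pdivlMr// ge_min lexx orbT.
have := hH h; rewrite h0 hrho => /(_ isT) H1.
have := @second_difference R n f g H u (h *: v) (h ^+ 2 * quadform (H u) v) (h ^+ 2 * e) fgH.
have h20 : 0 < h ^+ 2 by rewrite exprn_gt0.
move=> H2; have {}H2 : `|f (u + h *: v) + f (u - h *: v) - 2 * f u
    - h ^+ 2 * quadform (H u) v| <= h ^+ 2 * e.
  apply: H2 => s s1; rewrite (quadformZ _ h v) -mulrBr normrM (ger0_norm (ltW h20)).
  apply: ler_wpM2l; first exact: ltW.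
  apply: Hr; rewrite opprD addrA subrr sub0r normrN normrZ normrZ (gtr0_norm h0).
  by apply: le_lt_trans hv; rewrite ler_piMl// mulr_ge0// ltW.
rewrite -(ler_pM2l h20) -[X in X * `|_ - a|](ger0_norm (ltW h20)) -normrM.
move: H1 H2; rewrite !ler_norml mulrBr mulrDr => /andP[? ?] /andP[? ?].
by apply/andP; split; lra.
Qed.

(** The mean value theorem, applied once in each direction. *)
Lemma mixed_difference (R : realType) (n : nat) (f : 'cV[R]_n -> R) g H
    (z : 'cV[R]_n) (i j : 'I_n) (h : R) :
  jet2 f g H -> 0 < h ->
  exists2 w, `|w - z| <= 2 * h &
   f (z + h *: delta_mx j 0 + h *: delta_mx i 0) - f (z + h *: delta_mx i 0)
   - (f (z + h *: delta_mx j 0) - f z) = H w i j * h ^+ 2.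
Proof.
move=> [df dg _] h0; set ei := delta_mx i 0; set ej := delta_mx j 0.
have d1 (s : R) : is_derive s 1 (fun t => f (z + h *: ej + t *: ei) - f (z + t *: ei))
    (g (z + h *: ej + s *: ei) i 0 - g (z + s *: ei) i 0).
  have := is_deriveB (df (z + h *: ej) ei s) (df z ei s).
  by rewrite !dot_delta_mx.
have [c /andP[c0 ch]] := mvt_line h0 d1; rewrite !scale0r !addr0 => E1.
have d2 (s : R) : is_derive s 1 (fun t => g (z + c *: ei + t *: ej) i 0)
    (H (z + c *: ei + s *: ej) i j).
  by have := dg i (z + c *: ei) ej s; rewrite -colE mxE.
have [e /andP[e0 eh]] := mvt_line h0 d2; rewrite scale0r addr0 addrAC => E2.
exists (z + c *: ei + e *: ej); last by rewrite E1 E2 expr2 mulrA.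
rewrite addrAC [z + _ - z]addrAC subrr add0r (le_trans (ler_normD _ _))//.
have bnd k (t : R) : 0 < t -> t < h -> `|t *: (delta_mx k 0 : 'cV[R]_n)| <= h.
  move=> t0 th; rewrite normrZ gtr0_norm// (le_trans _ (ltW th))//.
  by rewrite ler_piMr ?norm_delta_mx// ltW.
by have := bnd i c c0 ch; have := bnd j e e0 eh; rewrite -/ei -/ej; lra.
Qed.

(** Both mixed partials are limits of one and the same mixed difference.  Without
    this symmetry the Newton point would not minimize the quadratic model. *)
Lemma jet2_sym (R : realType) (n : nat) (f : 'cV[R]_n -> R) g H z :
  jet2 f g H -> (H z)^T = H z.
Proof.
move=> fgH; apply/matrixP => i j; rewrite mxE; apply/eqP; rewrite -subr_eq0 -normr_le0.
apply/ler_addgt0Pr => e e0; rewrite add0r.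
have [_ _ cH] := fgH.
have e20 : 0 < e / 2 by rewrite divr_gt0.
have [r r0 Hr] := compact_unif_continuous (@compact_set1 _ z) cH e20.
have h0 : 0 < r / 4 by rewrite divr_gt0.
have [w1 w1z E1] := mixed_difference z i j fgH h0.
have [w2 w2z E2] := mixed_difference z j i fgH h0.
have E : H w1 i j = H w2 j i.
  apply: (@mulIf _ ((r / 4) ^+ 2)); first by rewrite gt_eqF// exprn_gt0.
  have swap (a b c t : R) : a - b - (c - t) = a - c - (b - t) by ring.
  apply: etrans (esym E1) (etrans _ E2).
  by rewrite (addrAC z); exact: swap.
have near w (k l : 'I_n) : `|w - z| <= 2 * (r / 4) -> `|H z k l - H w k l| <= e / 2.
  move=> wz; have wz' : `|z - w| < r by rewrite distrC; lra.
  have := Hr z w erefl wz' => /ltW; apply: le_trans.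
  by have := entry_le_norm (H z - H w) k l; rewrite !mxE.
have := near w1 i j w1z; have := near w2 j i w2z; rewrite E !ler_norml.
by move=> /andP[? ?] /andP[? ?]; apply/andP; split; lra.
Qed.

(** * Interpolation: Lipschitz continuity of the gradient in the other variable *)

Lemma quartering_ind (R : realType) (Pk : R -> Prop) :
  (forall k, 1 / 4 <= k <= 1 -> Pk k) ->
  (forall k, 0 < k <= 1 -> Pk k -> Pk (k / 4)) ->
  forall k, 0 < k <= 1 -> Pk k.
Proof.
move=> base step.
have H (n : nat) k : 1 <= 4 ^+ n * k -> k <= 1 -> Pk k.
  elim: n k => [|n IH] k; first by rewrite expr0 mul1r => k1 k2; apply: base; lra.
  rewrite exprSr -mulrA => nk k1.
  have [kge|klt] := leP (1 / 4) k; first by apply: base; rewrite kge.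
  rewrite (_ : k = (4 * k) / 4); last by field.
  have k41 : 4 * k <= 1 by lra.
  apply: step (IH _ nk k41); rewrite k41 andbT.
  by rewrite -(@pmulr_rgt0 _ (4 ^+ n)) ?exprn_gt0// (lt_le_trans _ nk).
move=> k /andP[k0 k1]; apply: (H (Num.bound k^-1)) => //.
rewrite -ler_pdivrMr// mul1r; apply: le_trans (ltW (archi_boundP _)) _.
  by rewrite invr_ge0 ltW.
by rewrite -natrX ler_nat ltnW// ltn_expl.
Qed.

(** The weights 20, 45, -1, -64 at k, 0, 4k, k/4 annihilate quadratic
    polynomials: they compare two estimates of the slope at 0, at the scales k
    and k/4, each exact on quadratics.  So the slope estimates at successive
    scales differ by O(sqrt k), which is summable over the scales k / 4 ^ n:
    they stay bounded, and with them the difference quotients. *)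
Lemma quadratic_approx_lipschitz_at0 (R : realType) (w : R -> R) (A M : R) :
  0 <= A -> (forall s, 0 <= s <= 4 -> `|w s - w 0| <= M) ->
  (forall k, 0 < k <= 1 -> exists c0 c1 c2 : R, forall s, 0 <= s <= 4 * k ->
     `|w s - (c0 + s * c1 + s ^+ 2 * c2)| <= A * (k * Num.sqrt k)) ->
  forall k, 0 < k <= 1 -> `|w k - w 0| <= (6 * M + 22 * A) * k.
Proof.
move=> A0 bnd approx; set K := 6 * M + 22 * A.
have M0 : 0 <= M by apply: le_trans (bnd 0 _); rewrite ?normr_ge0// lexx ler0n.
have slope k : 0 < k <= 1 ->
    `|16 * (w k - w 0) - (w (4 * k) - w 0)| <= 12 * k * (K - 22 * A * Num.sqrt k).
  move: k; apply: quartering_ind => k /andP[kl k1].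
    have s1 : Num.sqrt k <= 1 by rewrite -[leRHS]sqrtr1 ler_sqrt.
    have := bnd k; have := bnd (4 * k).
    have -> : 0 <= 4 * k <= 4 by apply/andP; split; lra.
    have -> : 0 <= k <= 4 by apply/andP; split; lra.
    move=> /(_ isT); rewrite ler_norml => /andP[? ?].
    move=> /(_ isT); rewrite ler_norml => /andP[? ?].
    have : 12 * k * (K - 22 * A) <= 12 * k * (K - 22 * A * Num.sqrt k).
      apply: ler_wpM2l; first lra.
      by rewrite lerB// ler_piMr//; lra.
    have : 3 * (K - 22 * A) <= 12 * k * (K - 22 * A).
      by apply: ler_wpM2r; rewrite /K; lra.
    by rewrite {1}/K ler_norml => ? ?; apply/andP; split; lra.
  have kk : 4 * (k / 4) = k by field.
  have sq4 : Num.sqrt (k / 4) = Num.sqrt k / 2.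
    rewrite sqrtrM ?ltW// (_ : 4^-1 = 2^-1 ^+ 2); last by field.
    by rewrite sqrtr_sqr ger0_norm.
  rewrite kk sq4; set q := Num.sqrt k => IH.
  have [c0 [c1 [c2 Hc]]] := approx k (introT andP (conj kl k1)).
  have Aq : 0 <= A * (k * q) by exact: mulr_ge0 A0 (mulr_ge0 (ltW kl) (sqrtr_ge0 _)).
  have N0 := Hc 0; have N1 := Hc (k / 4); have N2 := Hc k; have N3 := Hc (4 * k).
  have {}N0 := N0 ltac:(apply/andP; split; lra).
  have {}N1 := N1 ltac:(apply/andP; split; lra).
  have {}N2 := N2 ltac:(apply/andP; split; lra).
  have {}N3 := N3 ltac:(apply/andP; split; lra).
  move: N0 N1 N2 N3 IH; rewrite -/q !ler_norml.
  move=> /andP[? ?] /andP[? ?] /andP[? ?] /andP[? ?] /andP[? ?].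
  by apply/andP; split; lra.
have K0 : 0 <= K by rewrite /K; lra.
apply: quartering_ind => k /andP[kl k1].
  have := bnd k; have -> : 0 <= k <= 4 by apply/andP; split; lra.
  move=> /(_ isT) /le_trans; apply.
  apply: (@le_trans _ _ (K * (1 / 4))); first by rewrite /K; lra.
  by apply: ler_wpM2l; lra.
move=> IH.
have kk : 4 * (k / 4) = k by field.
have := slope (k / 4); have -> : 0 < k / 4 <= 1 by apply/andP; split; lra.
move=> /(_ isT); rewrite kk => H.
have {}H : `|16 * (w (k / 4) - w 0) - (w k - w 0)| <= 3 * k * K.
  apply: le_trans H _; rewrite [12 * _](_ : _ = 3 * k); last by field.
  apply: ler_wpM2l; first lra.
  by rewrite lerBlDr lerDl !mulr_ge0// sqrtr_ge0.
move: H IH; rewrite !ler_norml => /andP[? ?] /andP[? ?].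
by apply/andP; split; lra.
Qed.

Lemma jointly_continuous_bounded (R : realType) (d p : nat)
    (V : normedModType R) (Hz : 'cV[R]_p -> 'cV[R]_d -> V) (B M : R) :
  continuous (fun zx : 'cV[R]_d * 'cV[R]_p => Hz zx.2 zx.1) ->
  exists2 C : R, 0 < C & forall z x, `|z| <= B -> `|x| <= M -> `|Hz x z| <= C.
Proof.
move=> cm.
have [C C0 HC] := compact_norm_bounded
  (compact_setX (@compact_cV_ball R d B) (@compact_cV_ball R p M)) cm.
by exists C => // z x zB xM; apply: (HC (z, x)).
Qed.

Lemma jet2_first_order (R : realType) (n : nat) (f : 'cV[R]_n -> R) g H
    (z v : 'cV[R]_n) (C B : R) :
  jet2 f g H -> (forall u, `|u| <= B -> `|H u| <= C) -> `|z| + `|v| <= B ->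
  `|f (z + v) - f z - dot (g z) v| <= n%:R ^+ 2 * C * `|v| ^+ 2.
Proof.
move=> fgH hC zvB.
have bnd : forall s : R, 0 <= s <= 1 ->
   `|quadform (H (z + s *: v)) v - 0| <= n%:R ^+ 2 * C * `|v| ^+ 2.
  move=> s /andP[s0 s1]; rewrite subr0; apply: le_trans (quadform_le _ _) _.
  rewrite ler_wpM2r ?sqr_ge0// ler_wpM2l ?sqr_ge0//; apply: hC.
  apply: le_trans (ler_normD _ _) _; apply: le_trans zvB; rewrite lerD2l normrZ ger0_norm//.
  by rewrite ler_piMl.
have := taylor2_cV fgH bnd; rewrite mul0r subr0 => /le_trans; apply.
rewrite ler_pdivrMr// ler_peMr ?ler1n//.
by have := bnd 0; rewrite lexx ler01 => /(_ isT); apply: le_trans.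
Qed.

(** Separate continuity of m gives no joint bound.  At z = 0 the gradient is
    controlled by the differences m(e_l, x) - m(0, x), continuous in x; the bounded
    Hessian carries the bound to all z of the ball. *)
Lemma jets_grad_bounded (R : realType) (d p : nat)
    (m : 'cV[R]_d -> 'cV[R]_p -> R) gz Hz (B M : R) :
  (forall z, continuous (m z : _ -> R^o)) ->
  (forall x, jet2 (m ^~ x) (gz x) (Hz x)) ->
  continuous (fun zx : 'cV[R]_d * 'cV[R]_p => Hz zx.2 zx.1) ->
  exists C : R, forall z x l, `|z| <= B -> `|x| <= M -> `|gz x z l 0| <= C.
Proof.
move=> cm mgH cH; have [C C0 HC] := jointly_continuous_bounded (Num.max B 1) M cH.
have [C1 C10 HC1] := compact_norm_bounded (@compact_cV_ball R p M) (cm 0).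
have : exists C2 : R, forall l x, `|x| <= M -> `|m (delta_mx l 0) x| <= C2.
  have HCl l := compact_norm_bounded (@compact_cV_ball R p M) (cm (delta_mx l 0)).
  pose b l := sval (cid2 (HCl l)).
  exists (\sum_l b l) => l x xM; rewrite (bigD1 l)//=.
  have b0 k : 0 <= b k by rewrite /b; case: cid2 => /= c /ltW.
  have bnd : `|m (delta_mx l 0) x| <= b l by rewrite /b; case: cid2 => /= c _; apply.
  by apply: le_trans bnd _; rewrite lerDl sumr_ge0.
case=> C2 HC2; exists (C2 + C1 + d%:R ^+ 2 * C + d%:R * C * B) => z x l zB xM.
have max1 : 1 <= Num.max B 1 by rewrite le_max lexx orbT.
have P0 : `|gz x 0 l 0| <= C2 + C1 + d%:R ^+ 2 * C.
  have bnd := @jet2_first_order R d (m ^~ x) (gz x) (Hz x) 0 (delta_mx l 0) C 1 (mgH x).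
  rewrite normr0 !add0r norm_delta_mx in bnd.
  have {}bnd := bnd (fun u u1 => HC u x (le_trans u1 max1) xM) isT.
  rewrite dot_delta_mx in bnd.
  have Hd : d%:R ^+ 2 * C * `|delta_mx l 0 : 'cV[R]_d| ^+ 2 <= d%:R ^+ 2 * C.
    by rewrite ler_piMr ?mulr_ge0 ?sqr_ge0 ?exprn_ile1 ?norm_delta_mx// ltW.
  have := HC2 l x xM; have := HC1 x xM; move: (le_trans bnd Hd); rewrite !ler_norml.
  by move=> /andP[? ?] /andP[? ?] /andP[? ?]; apply/andP; split; lra.
have [_ dg _] := mgH x.
have [c /andP[c0 c1]] := mvt_line ltr01 (dg l 0 z).
rewrite scale0r scale1r !add0r mulr1 => E.
have Q : `|(Hz x (c *: z) *m z) l 0| <= d%:R * C * B.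
  rewrite mxE; apply: le_trans (ler_norm_sum _ _ _) _.
  rewrite -mulrA mulr_natl -[X in _ *+ X]card_ord -sumr_const; apply: ler_sum => j _.
  rewrite normrM; apply: ler_pM => //; last exact: le_trans (entry_le_norm _ _ _) zB.
  apply: le_trans (entry_le_norm _ _ _) _; apply: HC => //.
  rewrite normrZ gtr0_norm// le_max (le_trans _ zB)//.
  by rewrite ler_piMl// ltW.
rewrite -E in Q; move: P0 Q; rewrite !ler_norml => /andP[? ?] /andP[? ?].
by apply/andP; split; lra.
Qed.

(** Three derivatives in x and two in z leave room for one in each: by
    the choice h = k^(3/2), difference quotients in z of step h are, at scale k
    in x, quadratic up to k^3 / h, and approximate the partial derivative
    up to h. *)
Lemma jets_grad_lipschitz (R : realType) (d p : nat)
    (m : 'cV[R]_d -> 'cV[R]_p -> R) gx Hx gz Hz (L B M : R) :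
  (forall z, jet2 (m z) (gx z) (Hx z)) -> (forall x, jet2 (m ^~ x) (gz x) (Hz x)) ->
  (forall z, continuous (m z : _ -> R^o)) ->
  continuous (fun zx : 'cV[R]_d * 'cV[R]_p => Hz zx.2 zx.1) ->
  (forall z, l2norm z <= d%:R * (B + 1) ->
    forall x x', `|Hx z x - Hx z x'| <= L * l2norm (x - x')) ->
  exists2 C : R, 0 <= C & forall z x x' l, `|z| <= B -> `|x| <= M -> `|x - x'| <= 1 ->
    `|gz x' z l 0 - gz x z l 0| <= C * `|x - x'|.
Proof.
move=> mxH mzH cm cH Lip.
have [C C0 HC] := jointly_continuous_bounded (B + 1) (M + 4) cH.
have [N HN] := jets_grad_bounded B (M + 4) cm mzH cH.
pose Lx := p%:R ^+ 2 * (`|L| * p%:R).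
have Lx0 : 0 <= Lx by rewrite !mulr_ge0// sqr_ge0.
pose A := 64 * Lx + 2 * (d%:R ^+ 2 * C).
have A0 : 0 <= A by rewrite addr_ge0 ?mulr_ge0 ?sqr_ge0// ltW.
exists (`|6 * (2 * N) + 22 * A|) => // z x x' l zB xM x1.
have [->|xx'] := eqVneq x' x; first by rewrite subrr normr0 mulr_ge0.
set r := `|x - x'| in x1 *.
have r0 : 0 < r by rewrite normr_gt0 subr_eq0 eq_sym.
pose e := r^-1 *: (x' - x).
have e1 : `|e| = 1 by rewrite normrZ ger0_norm ?invr_ge0 1?distrC ?mulVf ?gt_eqF// ltW.
have re : x + r *: e = x' by rewrite scalerA divff ?gt_eqF// scale1r addrC subrK.
pose w s := gz (x + s *: e) z l 0.
have se s : 0 <= s -> `|x + s *: e| <= M + s.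
  by move=> s0; rewrite (le_trans (ler_normD _ _))// normrZ e1 mulr1 ger0_norm// lerD2r.
suff : `|w r - w 0| <= (6 * (2 * N) + 22 * A) * r.
  rewrite /w re scale0r addr0 => /le_trans; apply.
  by rewrite ler_wpM2r ?ler_norm// ltW.
apply: quadratic_approx_lipschitz_at0 => //; last by rewrite r0.
  move=> s /andP[s0 s4]; apply: le_trans (ler_normB _ _) _.
  by rewrite mulr2n mulrDl mul1r lerD// HN// (le_trans (se _ _))// lerD2l.
(* This step balances the two errors k ^+ 3 / h and h. *)
move=> k /andP[k0 k1]; pose h := k * Num.sqrt k.
have sk0 : 0 < Num.sqrt k by rewrite sqrtr_gt0.
have sk1 : Num.sqrt k <= 1 by rewrite -[leRHS]sqrtr1 ler_sqrt.
have h0 : 0 < h by rewrite mulr_gt0.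
have h1 : h <= 1 by rewrite mulr_ile1// ltW.
have hh : h ^+ 2 = k ^+ 3 by rewrite exprMn sqr_sqrtr ?ltW// -exprSr.
pose zh := z + h *: delta_mx l 0.
have hd : `|h *: delta_mx l 0 : 'cV[R]_d| <= h.
  by rewrite normrZ gtr0_norm// ler_piMr ?norm_delta_mx// ltW.
have zhB : `|zh| <= B + 1.
  by rewrite (le_trans (ler_normD _ _))// lerD// (le_trans hd).
pose a u := quadform (Hx u x) e.
pose b u := dot (gx u x) e.
have T u s : `|u| <= B + 1 -> 0 <= s <= 4 * k ->
    `|m u (x + s *: e) - m u x - s * b u - s ^+ 2 * a u / 2| <= 32 * Lx * k ^+ 3.
  move=> uB /andP[s0 s4].
  have Tay := @taylor2_cV R p (m u) (gx u) (Hx u) x (s *: e) (s ^+ 2 * a u)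
    (s ^+ 2 * (Lx * (4 * k))) (mxH u).
  rewrite dotZ in Tay; apply: le_trans (Tay _) _.
    move=> t /andP[t0 t1]; rewrite quadformZ -mulrBr normrM ger0_norm ?sqr_ge0//.
    apply: ler_wpM2l; first exact: sqr_ge0.
    rewrite -quadformB; apply: le_trans (quadform_le _ _) _.
    rewrite e1 expr1n mulr1 /Lx -[leRHS]mulrA; apply: ler_wpM2l; first exact: sqr_ge0.
    have uB' : l2norm u <= d%:R * (B + 1).
      by apply: le_trans (l2norm_le_norm _) _; rewrite ler_wpM2l.
    apply: le_trans (Lip u uB' _ _) _; rewrite addrAC subrr add0r.
    apply: le_trans (ler_wpM2r (l2norm_ge0 _) (ler_norm L)) _; rewrite -[leRHS]mulrA.
    apply: ler_wpM2l => //; apply: le_trans (l2norm_le_norm _) _.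
    apply: ler_wpM2l => //; rewrite normrZ normrZ e1 mulr1 !ger0_norm//.
    by apply: le_trans s4; rewrite ler_piMl.
  rewrite (_ : 32 * Lx * k ^+ 3 = (4 * k) ^+ 2 * (Lx * (4 * k)) / 2); last by field.
  rewrite ler_pM2r ?invr_gt0// ler_wpM2r ?mulr_ge0 ?(ltW k0)//.
  by rewrite ler_sqr// nnegrE ?mulr_ge0// ltW.
exists ((m zh x - m z x) / h), ((b zh - b z) / h), ((a zh - a z) / (2 * h)).
move=> s ss; have /andP[s0 s4] := ss.
have zB1 : `|z| <= B + 1 by rewrite (le_trans zB)// lerDl.
have T1 := T zh s zhB ss.
have T2 := T z s zB1 ss.
have T3 : `|m zh (x + s *: e) - m z (x + s *: e) - h * w s| <= d%:R ^+ 2 * C * k ^+ 3.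
  have := @jet2_first_order R d (m ^~ (x + s *: e)) _ _ z (h *: delta_mx l 0) C (B + 1) (mzH _).
  rewrite dotZ dot_delta_mx => /(_ _ _)/le_trans; apply.
  - move=> u uB; apply: HC => //; apply: le_trans (se _ s0) _; lra.
  - by rewrite lerD// (le_trans hd).
  - rewrite -hh; apply: ler_wpM2l; first by rewrite mulr_ge0 ?sqr_ge0// ltW.
    by rewrite ler_sqr ?nnegrE// ltW.
rewrite -/h -(ler_pM2l h0) -[X in X * `|_|](gtr0_norm h0) -normrM.
rewrite (_ : h * (A * h) = A * k ^+ 3); last by rewrite -hh; ring.
have -> : h * (w s - ((m zh x - m z x) / h + s * ((b zh - b z) / h)
      + s ^+ 2 * ((a zh - a z) / (2 * h)))) =
    h * w s - (m zh x - m z x) - s * (b zh - b z) - s ^+ 2 * (a zh - a z) / 2.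
  by field; rewrite gt_eqF.
move: T1 T2 T3; rewrite /A !ler_norml => /andP[? ?] /andP[? ?] /andP[? ?].
by apply/andP; split; lra.
Qed.

(** * Newton step and localization of minimizers *)

Lemma coercive_unitmx (R : realType) (n : nat) (H : 'M[R]_n) (lam : R) :
  0 < lam -> (forall v, lam * `|v| ^+ 2 <= quadform H v) -> H \in unitmx.
Proof.
move=> lam0 hH; rewrite -row_free_unit; apply: inj_row_free => v vH.
have := hH v^T; rewrite /quadform trmxK vH mul0mx mxE pmulr_rle0// => v0.
have /eqP : `|v^T| ^+ 2 = 0 by apply/le_anti; rewrite v0 sqr_ge0.
by rewrite expf_eq0 /= normr_eq0 => /eqP v0'; rewrite -[v]trmxK v0' trmx0.
Qed.

Lemma dotC (R : realType) (n : nat) (u v : 'cV[R]_n) : dot u v = dot v u.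
Proof. by rewrite !dotE; apply: eq_bigr => i _; rewrite mulrC. Qed.

Lemma dotDr (R : realType) (n : nat) (u v w : 'cV[R]_n) :
  dot u (v + w) = dot u v + dot u w.
Proof. by rewrite /dot mulmxDr mxE. Qed.

Lemma dotNl (R : realType) (n : nat) (u v : 'cV[R]_n) : dot (- u) v = - dot u v.
Proof. by rewrite dotC dotN dotC. Qed.

Lemma quadformD (R : realType) (n : nat) (H : 'M[R]_n) (u v : 'cV[R]_n) :
  H^T = H -> quadform H (u + v) = quadform H u + 2 * dot (H *m u) v + quadform H v.
Proof.
move=> symH; rewrite /quadform [(u + v)^T]linearD /= mulmxDr !mulmxDl.
have -> : v^T *m H *m u = u^T *m H *m v.
  have tr1 (A : 'M[R]_1) : A^T = A by apply/matrixP => i j; rewrite !ord1 mxE.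
  by rewrite -[LHS]tr1 !trmx_mul trmxK symH mulmxA.
have -> : dot (H *m u) v = (u^T *m H *m v) 0 0 by rewrite /dot trmx_mul symH.
by rewrite !mxE; ring.
Qed.

Lemma quadform_dot (R : realType) (n : nat) (H : 'M[R]_n) (u : 'cV[R]_n) :
  quadform H u = dot (H *m u) u.
Proof. by rewrite dotC /dot /quadform mulmxA. Qed.

Lemma sqr_normD_le (R : realType) (n : nat) (u v : 'cV[R]_n) :
  `|u + v| ^+ 2 <= 2 * `|u| ^+ 2 + 2 * `|v| ^+ 2.
Proof.
apply: (@le_trans _ _ ((`|u| + `|v|) ^+ 2)).
  by rewrite ler_sqr ?nnegrE ?addr_ge0// ler_normD.
by have := sqr_ge0 (`|u| - `|v|); rewrite !expr2; lra.
Qed.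

(** The Newton point minimizes exactly the quadratic model that f shares, up
    to eta |s|^2, with its true behaviour; strong convexity of the model keeps
    the true minimizer z1 from exploiting that error beyond the order of the
    squared Newton step. *)
Lemma newton_step_gap (R : realType) (n : nat) (f : 'cV[R]_n -> R)
    (z0 z1 g : 'cV[R]_n) (H : 'M[R]_n) (lam eta del r : R) :
  0 < lam -> 0 <= eta -> 8 * eta <= lam -> 0 <= del -> del <= lam * r ->
  H^T = H -> (forall v, lam * `|v| ^+ 2 <= quadform H v) ->
  (forall v, `|dot g v| <= del * `|v|) ->
  (forall s, `|s| <= r ->
     `|f (z0 + s) - f z0 - dot g s - quadform H s / 2| <= eta * `|s| ^+ 2) ->
  `|z1 - z0| <= r ->
  f (z0 - invmx H *m g) - f z1 <= 3 * eta * (del / lam) ^+ 2.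
Proof.
move=> lam0 eta0 etalam del0 dellam symH hH hg T z1r.
have uH := coercive_unitmx lam0 hH.
pose s := - (invmx H *m g); rewrite -/s.
have Hs : H *m s = - g by rewrite mulmxN mulmxA mulmxV// mul1mx.
have sdl : `|s| <= del / lam.
  rewrite ler_pdivlMr// mulrC.
  have [->|s0] := eqVneq s 0; first by rewrite normr0 mulr0.
  rewrite -(@ler_pM2r _ `|s|) ?normr_gt0// -mulrA -expr2.
  apply: le_trans (hH s) _; rewrite quadform_dot Hs dotNl.
  by apply: le_trans (ler_norm _) _; rewrite normrN.
have sr : `|s| <= r by rewrite (le_trans sdl)// ler_pdivrMr// mulrC.
(* Completing the square: the model at z1 exceeds its minimum by
   quadform H w / 2. *)
pose w := (z1 - z0) - s.
have sw : z1 - z0 = s + w by rewrite /w [s + _]addrC subrK.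
have := T _ z1r; rewrite (addrC z0) subrK => T1.
have := T _ sr => T2.
have Q : dot g (z1 - z0) + quadform H (z1 - z0) / 2 =
         dot g s + quadform H s / 2 + quadform H w / 2.
  by rewrite sw quadformD// dotDr Hs dotNl; field.
have W := sqr_normD_le s w; rewrite -sw in W.
have s2 : `|s| ^+ 2 <= (del / lam) ^+ 2.
  by rewrite ler_sqr ?nnegrE// divr_ge0// ltW.
have hw := hH w.
have e1 : 8 * eta * `|w| ^+ 2 <= lam * `|w| ^+ 2 by apply: ler_wpM2r => //; exact: sqr_ge0.
have e2 : eta * `|z1 - z0| ^+ 2 <= eta * (2 * `|s| ^+ 2 + 2 * `|w| ^+ 2) by exact: ler_wpM2l.
have e3 : eta * `|s| ^+ 2 <= eta * (del / lam) ^+ 2 by exact: ler_wpM2l.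
have e4 : 0 <= eta * `|w| ^+ 2 by rewrite mulr_ge0 ?sqr_ge0.
move: T1 T2; rewrite !ler_norml => /andP[? ?] /andP[? ?].
lra.
Qed.

Lemma interpolate0 (R : realType) (n : nat) (f0 f1 : 'cV[R]_n -> R) :
  interpolate f0 f1 0 = f0.
Proof. by apply/funext => z; rewrite /interpolate mul0r addr0. Qed.

Lemma interpolate1 (R : realType) (n : nat) (f0 f1 : 'cV[R]_n -> R) :
  interpolate f0 f1 1 = f1.
Proof. by apply/funext => z; rewrite /interpolate mul1r addrC subrK. Qed.

(** Inside the ball the quadratic models confine a minimizer z0 + s by
    3 lam |s|^2 / 8 <= del |s|, and del is small compared with lam r. *)
Lemma near_minimizer_nearer (R : realType) (n : nat) (f0 f1 : 'cV[R]_n -> R)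
    (z0 z g : 'cV[R]_n) (H : 'M[R]_n) (lam eta del r t : R) :
  0 < lam -> 0 <= eta -> 8 * eta <= lam -> 8 * del <= lam * r -> 0 < r ->
  (forall v, lam * `|v| ^+ 2 <= quadform H v) ->
  (forall v, `|dot g v| <= del * `|v|) ->
  (forall s, `|s| <= r ->
     `|f0 (z0 + s) - f0 z0 - quadform H s / 2| <= eta * `|s| ^+ 2) ->
  (forall s, `|s| <= r ->
     `|f1 (z0 + s) - f1 z0 - dot g s - quadform H s / 2| <= eta * `|s| ^+ 2) ->
  0 <= t <= 1 -> is_minimizer (interpolate f0 f1 t) z ->
  `|z - z0| <= r -> `|z - z0| <= r / 2.
Proof.
move=> lam0 eta0 etalam dellam r0 hH hg T0 T1 /andP[t0 t1] mz zr.
rewrite leNgt; apply/negP => rz.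
have := mz z0; rewrite /interpolate => mzz.
have := T0 _ zr; have := T1 _ zr; rewrite (addrC z0) subrK.
have := hH (z - z0); have := hg (z - z0).
move: rz; set N := `|z - z0|; set q := quadform _ _; set b := dot _ _ => rz Hb Hq.
rewrite !ler_norml => /andP[a1 _] /andP[a2 _].
have N0 : 0 < N by lra.
have {}a1 : t * (- (eta * N ^+ 2)) <= t * (f1 z - f1 z0 - b - q / 2) by exact: ler_wpM2l.
have {}a2 : (1 - t) * (- (eta * N ^+ 2)) <= (1 - t) * (f0 z - f0 z0 - q / 2).
  by apply: ler_wpM2l => //; lra.
have tb : t * b >= - (del * N).
  apply: le_trans (_ : t * (- (del * N)) <= _).
    by rewrite mulrN lerN2 ler_piMl// (le_trans _ Hb).
  by apply: ler_wpM2l => //; move: Hb; rewrite ler_norml => /andP[].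
have eN : 8 * eta * N ^+ 2 <= lam * N ^+ 2 by apply: ler_wpM2r => //; exact: sqr_ge0.
have c1 : 3 * (lam * N ^+ 2) <= 8 * (del * N) by lra.
have c2 : 8 * (del * N) <= lam * r * N by rewrite mulrA; apply: ler_wpM2r => //; lra.
have c3 : lam * (r / 2) * N < lam * N ^+ 2 by rewrite -mulrA expr2 ltr_pM2l// ltr_pM2r.
have : 0 < lam * r * N by rewrite !mulr_gt0.
by lra.
Qed.

(** Minimizers of the interpolated functions can leave the half ball around z0
    only by jumping out of the full ball, which uniqueness and compactness
    forbid: the parameters with a minimizer inside and those with a minimizer
    outside form two disjoint closed sets covering [0, 1]. *)
Lemma minimizer_path_stays_near (R : realType) (n : nat) (f0 f1 : 'cV[R]_n -> R)
    (z0 z1 : 'cV[R]_n) (r B : R) :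
  0 < r -> continuous (f0 : _ -> R^o) -> continuous (f1 : _ -> R^o) ->
  (forall t : R, 0 <= t <= 1 -> exists z, is_unique_minimizer (interpolate f0 f1 t) z) ->
  (forall (t : R) z, 0 <= t <= 1 -> is_minimizer (interpolate f0 f1 t) z -> `|z| <= B) ->
  (forall (t : R) z, 0 <= t <= 1 -> is_minimizer (interpolate f0 f1 t) z ->
     `|z - z0| <= r -> `|z - z0| <= r / 2) ->
  is_minimizer f0 z0 -> is_minimizer f1 z1 -> `|z1 - z0| <= r.
Proof.
move=> r0 c0 c1 uniq bnd gap m0 m1.
pose S := [set p : R * 'cV[R]_n | is_minimizer (interpolate f0 f1 p.1) p.2].
have cF (z : 'cV[R]_n) : continuous (fun p : R * 'cV[R]_n => interpolate f0 f1 p.1 z : R^o).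
  move=> p; apply: cvgD; first exact: cvg_cst.
  by apply: cvgM; [exact: cvg_fst|exact: cvg_cst].
have cG : continuous (fun p : R * 'cV[R]_n => interpolate f0 f1 p.1 p.2 : R^o).
  move=> p.
  have s0 : (fun p : R * 'cV[R]_n => f0 p.2 : R^o) @ p --> (f0 p.2 : R^o).
    by apply: (@cvg_comp _ _ _ snd); [exact: cvg_snd|exact: c0].
  have s1 : (fun p : R * 'cV[R]_n => f1 p.2 : R^o) @ p --> (f1 p.2 : R^o).
    by apply: (@cvg_comp _ _ _ snd); [exact: cvg_snd|exact: c1].
  by apply: cvgD => //; apply: cvgM; [exact: cvg_fst|exact: cvgB].
have clS : closed S.
  rewrite (_ : S = \bigcap_z [set p | interpolate f0 f1 p.1 p.2 <= interpolate f0 f1 p.1 z]).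
    apply: closed_bigI => z _.
    rewrite (_ : [set p | _] = (fun p => interpolate f0 f1 p.1 z
        - interpolate f0 f1 p.1 p.2) @^-1` [set x | 0 <= x]).
      apply: closed_comp (@closed_ge _ 0) => p _.
      by apply: cvgB; [exact: cF|exact: cG].
    by apply/seteqP; split => p /=; rewrite subr_ge0.
  by apply/seteqP; split => [p mp z _|p mp z]; [exact: mp|exact: (mp z I)].
have cP : compact (`[0, 1] `*` [set z : 'cV[R]_n | `|z| <= B] : set (R * 'cV[R]_n)).
  by apply: compact_setX; [exact: segment_compact|exact: compact_cV_ball].
pose proj (D : set R) := fst @`
   ((`[0, 1] `*` [set z : 'cV[R]_n | `|z| <= B]) `&`
    (S `&` (fun p : R * 'cV[R]_n => `|p.2 - z0|) @^-1` D)).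
have cproj D : closed D -> closed (proj D).
  move=> cD; apply: compact_closed; first exact: Rhausdorff.
  apply: continuous_compact; first by apply: continuous_subspaceT => p; exact: cvg_fst.
  apply: (subclosed_compact _ cP); last by move=> p [].
  have -> : `[0, 1] `*` [set z : 'cV[R]_n | `|z| <= B] =
      (fst @^-1` `[0, 1]) `&` ((fun p : R * 'cV[R]_n => `|p.2|) @^-1` [set x | x <= B]) by [].
  apply: closedI; [apply: closedI|apply: closedI => //].
  - by apply: preimage_closed; [move=> p _; exact: cvg_fst|exact: itv_closed].
  - apply: preimage_closed; last exact: closed_le.
    by move=> p _; apply: cvg_norm; exact: cvg_snd.
  - apply: preimage_closed cD => p _.
    by apply: cvg_norm; apply: cvgB; [exact: cvg_snd|exact: cvg_cst].
(* Parameters of the minimizers inside and outside, respectively. *)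
pose T1 := proj [set x | x <= r / 2]; pose T2 := proj [set x | x >= r].
have T12 t : `[0, 1]%classic t -> ~ T2 t -> T1 t.
  move=> /= t01 nT2; have {}t01 : 0 <= t <= 1 by rewrite in_itv in t01.
  have [z [mz _]] := uniq t t01.
  exists (t, z) => //; split; first by split; [rewrite /= in_itv|exact: (bnd _ _ t01 mz)].
  split => //=; apply: (gap t z t01 mz); rewrite leNgt; apply/negP => rz.
  apply: nT2; exists (t, z) => //; split.
    by split; [rewrite /= in_itv|exact: (bnd _ _ t01 mz)].
  by split => //=; exact: ltW.
have T1E : T1 = `[0, 1]%classic.
  apply: (@segment_connected R 0 1).
  - exists 0, (0, z0) => //.
    have m00 : is_minimizer (interpolate f0 f1 0) z0 by rewrite interpolate0.
    have t01 : 0 <= (0 : R) <= 1 by rewrite lexx ler01.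
    split; first by split; [rewrite /= in_itv|exact: (bnd _ _ t01 m00)].
    by split => //=; rewrite subrr normr0 divr_ge0// ltW.
  - exists (~` T2); first by rewrite openC; apply: cproj; exact: closed_ge.
    apply/seteqP; split => [t T1t|t [t01 nT2]]; last exact: T12.
    split; first by case: T1t => p [[? _] _] <-.
    case: T1t => -[t1 z] [[/= t01 zB] [mz zr]] /= <-.
    case=> -[t2 y] [[_ yB] [my yr]] /= E; rewrite /S /= E in my.
    rewrite in_itv in t01; have [z' [_ uz']] := uniq t1 t01.
    have /= Ez := uz' _ mz; have /= Ey := uz' _ my.
    by move: zr yr => /=; rewrite Ez Ey; lra.
  - exists T1; first by apply: cproj; exact: closed_le.
    by apply/seteqP; split => [t T1t|t []//]; split => //; case: T1t => p [[? _] _] <-.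
have [] : T1 1 by rewrite T1E /= in_itv /= ler01 lexx.
move=> -[t z] [_ [mz zr]] /= t1; rewrite /S /= t1 in mz.
have t01 : 0 <= (1 : R) <= 1 by rewrite lexx ler01.
have [z' [_ uz']] := uniq 1 t01.
rewrite (uz' z1); last by rewrite interpolate1.
have /= Ez := uz' _ mz; by move: zr => /=; rewrite Ez; lra.
Qed.

(** * Costs as averages *)

Lemma region_expectationE (R : realType) (dO : measure_display)
    (Omega : measurableType dO) (P : probability Omega R) (p : nat)
    (X : Omega -> 'cV[R]_p) (U : Omega -> R) (A : set 'cV[R]_p) :
  region_expectation P X U A = \int[P]_(w in X @^-1` A) U w.
Proof.
rewrite Rintegral_mkcond patch_indic /region_expectation /Rintegral.
by rewrite unlock.
Qed.

(** Linearity and monotonicity of averaging over A in a single property, which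
    is all that the comparison of derivatives of f and of m uses. *)
Definition is_mean (R : realType) (d p : nat) (m : 'cV[R]_d -> 'cV[R]_p -> R)
    (A : set 'cV[R]_p) (f : 'cV[R]_d -> R) : Prop :=
  forall (s : seq (R * 'cV[R]_d)) (a e : R),
    (forall x, A x -> `|\sum_(k <- s) k.1 * m k.2 x - a| <= e) ->
    `|\sum_(k <- s) k.1 * f k.2 - a| <= e.

Lemma is_mean_nonempty (R : realType) (d p : nat)
    (m : 'cV[R]_d -> 'cV[R]_p -> R) A f : is_mean m A f -> A !=set0.
Proof.
move=> mean; apply: contrapT => A0.
have : `|\sum_(k <- [::]) k.1 * f k.2 - 1| <= 0.
  by apply: mean => x Ax; case: A0; exists x.
by rewrite big_nil sub0r normrN normr1 ler10.
Qed.

Lemma cond_cost_is_mean (R : realType) (dO : measure_display)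
    (Omega : measurableType dO) (P : probability Omega R)
    (p d : nat) (YT : Type) (c : 'cV[R]_d -> YT -> R) (X : Omega -> 'cV[R]_p)
    (Y : Omega -> YT) (m : 'cV[R]_d -> 'cV[R]_p -> R) (A : set 'cV[R]_p) :
  random_vector X -> is_cond_cost_given_X P c X Y m -> borel A ->
  0 < region_prob P X A -> is_mean m A (cond_cost P c X Y A).
Proof.
move=> hX hm bA pA s a e bnd; set D := X @^-1` A.
have mD : measurable D by exact: hX.
have costE z : cond_cost P c X Y A z = (\int[P]_(w in D) m z (X w)) / region_prob P X A.
  by have [_ _ /(_ _ bA) E] := hm z; rewrite /cond_cost -E region_expectationE.
have int1 z : P.-integrable D (EFin \o (fun w => m z (X w))).
  by have [_ int _] := hm z; apply: integrableS int => //; exact: measurableT.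
have intc (r : R) : P.-integrable D (EFin \o (fun=> r)).
  exact: finite_measure_integrable_cst.
pose G w := \sum_(k <- s) k.1 * m k.2 (X w).
have [intG GE] : P.-integrable D (EFin \o G) /\
    \int[P]_(w in D) G w = (\sum_(k <- s) k.1 * cond_cost P c X Y A k.2) * region_prob P X A.
  rewrite {}/G {bnd}; elim: s => [|k s [IH1 IH2]].
    under eq_fun do rewrite big_nil; split=> //.
    by rewrite Rintegral_cst// big_nil !mul0r.
  under eq_fun do rewrite big_cons.
  have intk : P.-integrable D (EFin \o (fun w => k.1 * m k.2 (X w))).
    exact: (integrableZl mD k.1 (int1 k.2)).
  split; first exact: (integrableD mD intk IH1).
  rewrite RintegralD// IH2 RintegralZl// big_cons mulrDl costE -mulrA divfK//.
  by rewrite gt_eqF.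
have pE (r : R) : \int[P]_(w in D) r = r * region_prob P X A by rewrite Rintegral_cst.
have lo : (a - e) * region_prob P X A <= \int[P]_(w in D) G w.
  rewrite -pE; apply: le_Rintegral => // w Dw.
  by have := bnd (X w) Dw; rewrite ler_norml => /andP[]; rewrite /G; lra.
have up : \int[P]_(w in D) G w <= (a + e) * region_prob P X A.
  rewrite -pE; apply: le_Rintegral => // w Dw.
  by have := bnd (X w) Dw; rewrite ler_norml => /andP[]; rewrite /G; lra.
move: lo up; rewrite GE !ler_pM2r// => lo up.
by rewrite ler_norml; apply/andP; split; lra.
Qed.

(** Bounds on first differences pass to means, and from there to derivatives:
    no differentiation under the integral sign, hence no measurability of the
    derivatives of m, is involved. *)
Lemma mean_grad (R : realType) (d p : nat) (m : 'cV[R]_d -> 'cV[R]_p -> R) gz Hz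
    (A : set 'cV[R]_p) f g H (z v : 'cV[R]_d) (C b e : R) :
  (forall x, jet2 (m ^~ x) (gz x) (Hz x)) -> jet2 f g H -> is_mean m A f ->
  (forall x u, A x -> `|u| <= `|z| + `|v| -> `|Hz x u| <= C) ->
  (forall x, A x -> `|dot (gz x z) v - b| <= e) -> `|dot (g z) v - b| <= e.
Proof.
move=> mzH fgH mean hC he.
have [_ _ cH] := fgH.
have [C' C'0 hC'] := compact_norm_bounded (@compact_cV_ball R d (`|z| + `|v|)) cH.
have [x0 Ax0] := is_mean_nonempty mean.
have C0 : 0 <= C by apply: le_trans (hC x0 z Ax0 _); rewrite ?lerDl.
pose K := d%:R ^+ 2 * (C + C') * `|v| ^+ 2.
have K0 : 0 <= K by rewrite mulr_ge0 ?sqr_ge0// mulr_ge0 ?sqr_ge0// addr_ge0// ltW.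
suff small h : 0 < h <= 1 -> `|dot (g z) v - b| <= e + h * K.
  apply/ler_addgt0Pr => eps eps0.
  have K1 : 0 < K + 1 by rewrite ltr_wpDl.
  apply: le_trans (small (Num.min 1 (eps / (K + 1))) _) _.
    by rewrite lt_min ltr01 divr_gt0//= ge_min lexx.
  rewrite lerD2l; apply: (@le_trans _ _ (eps / (K + 1) * K)).
    by rewrite ler_wpM2r// ge_min lexx orbT.
  by rewrite mulrAC ler_pdivrMr// ler_wpM2l// ?ltW// ltrDl.
move=> /andP[h0 h1].
have hv : `|z| + `|h *: v| <= `|z| + `|v| by rewrite lerD2l normrZ gtr0_norm// ler_piMl.
have Kh C1 : d%:R ^+ 2 * C1 * `|h *: v| ^+ 2 = h ^+ 2 * (d%:R ^+ 2 * C1 * `|v| ^+ 2).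
  by rewrite normrZ gtr0_norm// exprMn; ring.
have F := jet2_first_order fgH hC' hv; rewrite dotZ Kh in F.
have M : `|f (z + h *: v) - f z - h * b| <= h * e + h ^+ 2 * (d%:R ^+ 2 * C * `|v| ^+ 2).
  have := mean [:: (1, z + h *: v); (-1, z)] (h * b)
    (h * e + h ^+ 2 * (d%:R ^+ 2 * C * `|v| ^+ 2)).
  rewrite !big_cons !big_nil /= !mul1r !mulN1r !addr0; apply=> x Ax.
  rewrite !big_cons !big_nil /= !mul1r !mulN1r !addr0.
  have Fx := jet2_first_order (mzH x) (fun u => hC x u Ax) hv; rewrite dotZ Kh in Fx.
  have := he x Ax; rewrite -(ler_pM2l h0) -[X in X * `|_|](gtr0_norm h0) -normrM.
  by move: Fx; rewrite !ler_norml => /andP[? ?] /andP[? ?]; apply/andP; split; lra.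
rewrite -(ler_pM2l h0) -[X in X * `|_|](gtr0_norm h0) -normrM.
rewrite (_ : h * (e + h * K) = h * e + h ^+ 2 * (d%:R ^+ 2 * C * `|v| ^+ 2) +
   h ^+ 2 * (d%:R ^+ 2 * C' * `|v| ^+ 2)); last by rewrite /K; ring.
by move: F M; rewrite !ler_norml => /andP[? ?] /andP[? ?]; apply/andP; split; lra.
Qed.

(** The Hessian analogue, with second differences; the bound is required on a
    neighbourhood of u because a second difference at u looks at that of m. *)
Lemma mean_hess (R : realType) (d p : nat) (m : 'cV[R]_d -> 'cV[R]_p -> R) gz Hz
    (A : set 'cV[R]_p) f g H (u v : 'cV[R]_d) (a e rho : R) :
  (forall x, jet2 (m ^~ x) (gz x) (Hz x)) -> jet2 f g H -> is_mean m A f -> 0 < rho ->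
  (forall x u', A x -> `|u - u'| < rho -> `|quadform (Hz x u') v - a| <= e) ->
  `|quadform (H u) v - a| <= e.
Proof.
move=> mzH fgH mean rho0 he.
have v1 : 0 < `|v| + 1 by rewrite ltr_wpDl.
apply: (hess_of_second_differences fgH (divr_gt0 rho0 v1)) => h /andP[h0 hlt].
have hv : h * `|v| < rho.
  apply: (@le_lt_trans _ _ (h * (`|v| + 1))); first by rewrite ler_pM2l// lerDl.
  by rewrite -ltr_pdivlMr.
have := mean [:: (1, u + h *: v); (1, u - h *: v); (-2, u)] (h ^+ 2 * a) (h ^+ 2 * e).
have E (x y t : R) : 1 * x + (1 * y + (-2 * t + 0)) = x + y - 2 * t by ring.
rewrite !big_cons !big_nil /= E; apply=> x Ax.
rewrite !big_cons !big_nil /= E.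
apply: (second_difference (mzH x)) => s s1.
rewrite (quadformZ _ h v) -mulrBr normrM (ger0_norm (sqr_ge0 h)).
apply: ler_wpM2l; first exact: sqr_ge0.
apply: he => //; rewrite opprD addrA subrr sub0r normrN normrZ normrZ (gtr0_norm h0).
by apply: le_lt_trans hv; rewrite ler_piMl// mulr_ge0// ltW.
Qed.

(** * The error on one subregion *)

Lemma minimizer_grad0 (R : realType) (n : nat) (f : 'cV[R]_n -> R) g H z v :
  jet2 f g H -> is_minimizer f z -> dot (g z) v = 0.
Proof.
move=> [df _ _] mz.
have D := df z v 0; rewrite scale0r addr0 in D.
have D0 : is_derive (0 : R) 1 (fun t => f (z + t *: v)) 0.
  apply: (@derive1_at_min _ _ (-1) 1) => //.
  - by rewrite in_itv /= ltrN10 ltr01.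
  - by move=> t _; rewrite scale0r addr0; exact: mz.
by rewrite -(@derive_val _ _ _ _ _ _ _ D) (@derive_val _ _ _ _ _ _ _ D0).
Qed.

Lemma jets_hess_close (R : realType) (d p : nat) (Hz : 'cV[R]_p -> 'cV[R]_d -> 'M[R]_d)
    (B M eta : R) :
  continuous (fun zx : 'cV[R]_d * 'cV[R]_p => Hz zx.2 zx.1) -> 0 < eta ->
  exists2 r : R, 0 < r & forall z0 u x0 x v, `|z0| <= B -> `|x0| <= M ->
    `|z0 - u| < r -> `|x0 - x| < r ->
    `|quadform (Hz x u) v - quadform (Hz x0 z0) v| <= eta * `|v| ^+ 2.
Proof.
move=> cH eta0; set k : R := d%:R ^+ 2 + 1.
have k0 : 0 < k by rewrite ltr_wpDl// sqr_ge0.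
have [r r0 Hr] := compact_unif_continuous
  (compact_setX (@compact_cV_ball R d B) (@compact_cV_ball R p M)) cH (divr_gt0 eta0 k0).
exists r => // z0 u x0 x v z0B x0M zu xx.
have {}Hr : `|Hz x0 z0 - Hz x u| < eta / k.
  by apply: (Hr (z0, x0) (u, x)) => //; rewrite prod_normE /= gt_max zu.
rewrite -quadformB; apply: le_trans (quadform_le _ _) _.
apply: ler_wpM2r; first exact: sqr_ge0.
rewrite distrC; apply: (@le_trans _ _ (k * (eta / k))).
  by apply: ler_pM => //; rewrite ?sqr_ge0// ?lerDl// ltW.
by rewrite mulrC divfK// gt_eqF.
Qed.

Lemma dot_le (R : realType) (n : nat) (u v : 'cV[R]_n) (C : R) :
  0 <= C -> (forall l, `|u l 0| <= C) -> `|dot u v| <= n%:R * C * `|v|.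
Proof.
move=> C0 hu; rewrite dotE; apply: le_trans (ler_norm_sum _ _ _) _.
rewrite -mulrA mulr_natl -[X in _ *+ X]card_ord -sumr_const; apply: ler_sum => j _.
by rewrite normrM ler_pM// entry_le_norm.
Qed.

Lemma dotBl (R : realType) (n : nat) (u v w : 'cV[R]_n) :
  dot (u - v) w = dot u w - dot v w.
Proof. by rewrite dotC dotDr dotN dotC (dotC w). Qed.

(** The gradient of f1 at z0, hence the Newton step, is of order D, which turns
    the o(1) accuracy of the quadratic model into o(D^2).  That rho depends on the
    regions only through B, M and lam lets them vary along any filter. *)
Lemma region_gap (R : realType) (d p : nat)
    (m : 'cV[R]_d -> 'cV[R]_p -> R) gx Hx gz Hz (L B M lam eps : R) :
  (forall z, jet2 (m z) (gx z) (Hx z)) -> (forall x, jet2 (m ^~ x) (gz x) (Hz x)) ->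
  (forall z, continuous (m z : _ -> R^o)) ->
  continuous (fun zx : 'cV[R]_d * 'cV[R]_p => Hz zx.2 zx.1) ->
  (forall z, l2norm z <= d%:R * (B + 1) ->
    forall x x', `|Hx z x - Hx z x'| <= L * l2norm (x - x')) ->
  0 < lam -> 0 < eps ->
  exists2 rho : R, 0 < rho &
  forall (R0 A : set 'cV[R]_p) f0 g0 H0 f1 g1 H1 z0 z1 (D : R),
    A `<=` R0 -> (forall x, R0 x -> `|x| <= M) ->
    (forall x x', R0 x -> R0 x' -> `|x - x'| <= D) -> D < rho ->
    is_mean m R0 f0 -> is_mean m A f1 -> jet2 f0 g0 H0 -> jet2 f1 g1 H1 ->
    continuous (f0 : _ -> R^o) -> continuous (f1 : _ -> R^o) ->
    (forall v, lam * `|v| ^+ 2 <= quadform (H0 z0) v) ->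
    (forall t : R, 0 <= t <= 1 -> exists z, is_unique_minimizer (interpolate f0 f1 t) z) ->
    (forall (t : R) z, 0 <= t <= 1 -> is_minimizer (interpolate f0 f1 t) z -> `|z| <= B) ->
    is_minimizer f0 z0 -> is_minimizer f1 z1 ->
    f1 (z0 - invmx (H0 z0) *m g1 z0) - f1 z1 <= eps * D ^+ 2.
Proof.
move=> mxH mzH cm cH Lip lam0 eps0.
have [Cg Cg0 hCg] := jets_grad_lipschitz M mxH mzH cm cH Lip.
pose k := 2 * (d%:R * Cg).
have k0 : 0 <= k by rewrite !mulr_ge0.
(* The error bound of newton_step_gap is kap * eta * D ^+ 2. *)
pose kap := 3 * (k / lam) ^+ 2.
have kap0 : 0 <= kap by rewrite mulr_ge0// sqr_ge0.
have kap1 : 0 < kap + 1 by rewrite ltr_wpDl.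
pose eta := Num.min (lam / 8) (eps / (kap + 1)).
have eta0 : 0 < eta by rewrite lt_min !divr_gt0.
have etalam : 8 * eta <= lam by rewrite mulrC -ler_pdivlMr// ge_min lexx.
have etaeps : kap * eta <= eps.
  apply: (@le_trans _ _ ((kap + 1) * eta)); first by rewrite ler_pM2r// lerDl.
  by rewrite mulrC -ler_pdivlMr// ge_min lexx orbT.
have [r r0 hr] := jets_hess_close B M cH (divr_gt0 eta0 (ltr0n _ 2)).
have k1 : 0 < 16 * k + 1 by rewrite ltr_wpDl// mulr_ge0.
exists (Num.min (Num.min r 1) (lam * r / (16 * k + 1))).
  by rewrite !lt_min r0 ltr01 divr_gt0// mulr_gt0.
move=> R0 A f0 g0 H0 f1 g1 H1 z0 z1 D AR0 R0M R0D.
rewrite !lt_min => /andP[/andP[Dr D1]]; rewrite ltr_pdivlMr// => Dlam.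
move=> mean0 mean1 jet0 jet1 c0 c1 hlam uniq bnd m0 m1.
have [x0 R0x0] := is_mean_nonempty mean0.
have D0 : 0 <= D by apply: le_trans (R0D x0 x0 R0x0 R0x0).
have x0M := R0M _ R0x0.
have m0' : is_minimizer (interpolate f0 f1 0) z0 by rewrite interpolate0.
have t0 : 0 <= (0 : R) <= 1 by rewrite lexx ler01.
have z0B := bnd _ _ t0 m0'.
(* Bound on the norm of the gradient of f1 at z0. *)
pose del := k * D.
have del0 : 0 <= del by rewrite mulr_ge0.
have grad_near v x : R0 x -> `|dot (gz x z0) v - dot (gz x0 z0) v| <= d%:R * (Cg * D) * `|v|.
  move=> R0x; rewrite -dotBl; apply: dot_le; first exact: mulr_ge0.
  move=> l; rewrite !mxE; have xx := R0D x0 x R0x0 R0x.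
  apply: le_trans (hCg z0 x0 x l z0B x0M (le_trans xx (ltW D1))) _.
  exact: ler_wpM2l.
have hg v : `|dot (g1 z0) v| <= del * `|v|.
  have [C C0 hC] := jointly_continuous_bounded (`|z0| + `|v|) M cH.
  have M0 := mean_grad mzH jet0 mean0 (fun x u R0x uv => hC u x uv (R0M x R0x))
    (fun x R0x => grad_near v x R0x).
  have M1 := mean_grad mzH jet1 mean1 (fun x u Ax uv => hC u x uv (R0M x (AR0 _ Ax)))
    (fun x Ax => grad_near v x (AR0 _ Ax)).
  rewrite (minimizer_grad0 v jet0 m0) in M0.
  have -> : del * `|v| = 2 * (d%:R * (Cg * D) * `|v|) by rewrite /del /k; ring.
  by move: M0 M1; rewrite !ler_norml => /andP[? ?] /andP[? ?]; apply/andP; split; lra.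
have hess_near A' f g H u v : A' `<=` R0 -> is_mean m A' f -> jet2 f g H -> `|z0 - u| < r ->
    `|quadform (H u) v - quadform (Hz x0 z0) v| <= eta / 2 * `|v| ^+ 2.
  move=> A'R0 mean jet zu.
  have ru : 0 < r - `|z0 - u| by rewrite subr_gt0.
  apply: (mean_hess mzH jet mean ru) => x u' A'x uu'; apply: hr => //.
    by apply: le_lt_trans (ler_distD u _ _) _; lra.
  exact: le_lt_trans (R0D _ _ R0x0 (A'R0 _ A'x)) Dr.
have taylor A' f g H s : A' `<=` R0 -> is_mean m A' f -> jet2 f g H -> `|s| <= r / 2 ->
    `|f (z0 + s) - f z0 - dot (g z0) s - quadform (H0 z0) s / 2| <= eta * `|s| ^+ 2.
  move=> A'R0 mean jet sr.
  have : `|f (z0 + s) - f z0 - dot (g z0) s - quadform (H0 z0) s / 2| <= eta * `|s| ^+ 2 / 2.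
    apply: (taylor2_cV jet) => t /andP[t0' t1].
    have zu : `|z0 - (z0 + t *: s)| < r.
      rewrite opprD addrA subrr sub0r normrN normrZ ger0_norm//.
      apply: (@le_lt_trans _ _ `|s|); first by rewrite ler_piMl.
      by apply: le_lt_trans sr _; lra.
    have zz : `|z0 - z0| < r by rewrite subrr normr0.
    have h1 := hess_near A' f g H (z0 + t *: s) s A'R0 mean jet zu.
    have h2 := hess_near R0 f0 g0 H0 z0 s (fun _ h => h) mean0 jet0 zz.
    by move: h1 h2; rewrite !ler_norml => /andP[? ?] /andP[? ?]; apply/andP; split; lra.
  move=> /le_trans; apply; rewrite ler_pdivrMr// ler_peMr ?ler1n//.
  by rewrite mulr_ge0 ?sqr_ge0// ltW.
have T1 s : `|s| <= r / 2 -> `|f1 (z0 + s) - f1 z0 - dot (g1 z0) s - quadform (H0 z0) s / 2|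
    <= eta * `|s| ^+ 2 by apply: (taylor A f1 g1 H1).
have T0 s : `|s| <= r / 2 -> `|f0 (z0 + s) - f0 z0 - quadform (H0 z0) s / 2|
    <= eta * `|s| ^+ 2.
  move=> sr; have := taylor R0 f0 g0 H0 s (fun _ h => h) mean0 jet0 sr.
  by rewrite (minimizer_grad0 s jet0 m0) subr0.
have r20 : 0 < r / 2 by rewrite divr_gt0.
have dellam : 8 * del <= lam * (r / 2) by rewrite /del; lra.
have z1r : `|z1 - z0| <= r / 2.
  apply: (minimizer_path_stays_near r20 c0 c1 uniq bnd _ m0 m1) => t z t01 mz.
  exact: (near_minimizer_nearer lam0 (ltW eta0) etalam dellam r20 hlam hg T0 T1 t01 mz).
have dellam' : del <= lam * (r / 2) by lra.
apply: le_trans (newton_step_gap lam0 (ltW eta0) etalam del0 dellam' (jet2_sym z0 jet0)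
  hlam hg T1 z1r) _.
rewrite (_ : 3 * eta * (del / lam) ^+ 2 = kap * eta * D ^+ 2); last first.
  by rewrite /del /kap; field; rewrite gt_eqF.
by apply: ler_wpM2r => //; exact: sqr_ge0.
Qed.

(** * Diameter, oracle criterion and conclusion *)

Lemma l2norm_le_diameter (R : realType) (n : nat) (A : set 'cV[R]_n) (M : R) x y :
  (forall x, A x -> l2norm x <= M) -> A x -> A y -> l2norm (x - y) <= diameter A.
Proof.
move=> bnd Ax Ay; apply: ub_le_sup; last by exists (x, y).
exists (2 * M) => _ [[u v] [/= Au Av] <-].
have M0 : 0 <= M by apply: le_trans (bnd _ Ax); exact: l2norm_ge0.
have sq w : A w -> l2norm w ^+ 2 <= M ^+ 2.
  by move=> Aw; rewrite ler_sqr ?nnegrE ?l2norm_ge0//; exact: bnd.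
rewrite -ler_sqr ?nnegrE ?l2norm_ge0 ?mulr_ge0//.
apply: (@le_trans _ _ (2 * l2norm u ^+ 2 + 2 * l2norm v ^+ 2)).
  rewrite !sqr_l2norm !mulr_sumr -big_split /=; apply: ler_sum => i _.
  rewrite !mxE; have := sqr_ge0 (u i 0 + v i 0); rewrite !expr2; lra.
by have := sq u Au; have := sq v Av; rewrite !expr2; lra.
Qed.

Lemma oracle_termE (R : realType) (dO : measure_display)
    (Omega : measurableType dO) (P : probability Omega R)
    (p d : nat) (YT : Type) (c : 'cV[R]_d -> YT -> R) (X : Omega -> 'cV[R]_p)
    (Y : Omega -> YT) (A : set 'cV[R]_p) (z1 : 'cV[R]_d) :
  0 < region_prob P X A -> is_minimizer (cond_cost P c X Y A) z1 ->
  oracle_term P c X Y A = region_prob P X A * cond_cost P c X Y A z1.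
Proof.
move=> p0 m1.
have E z : region_expectation P X (fun w => c z (Y w)) A =
    region_prob P X A * cond_cost P c X Y A z.
  by rewrite /cond_cost mulrC divfK// gt_eqF.
have lb : lbound (range (fun z => region_expectation P X (fun w => c z (Y w)) A))
    (region_prob P X A * cond_cost P c X Y A z1).
  by move=> _ [z _ <-]; rewrite E ler_pM2l.
rewrite /oracle_term; apply/eqP; rewrite eq_le; apply/andP; split.
  by apply: ge_inf; [eexists; exact: lb|exists z1 => //; exact: E].
by apply: lb_le_inf => //; exists (region_expectation P X (fun w => c z1 (Y w)) A), z1.
Qed.

Lemma region_prob_le1 (R : realType) (dO : measure_display)
    (Omega : measurableType dO) (P : probability Omega R) (p : nat)
    (X : Omega -> 'cV[R]_p) (A : set 'cV[R]_p) :
  random_vector X -> borel A -> region_prob P X A <= 1.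
Proof.
move=> hX bA; rewrite -lee_fin /region_prob fineK.
  exact/probability_le1/hX.
exact/fin_num_measure/hX.
Qed.

Lemma region_prob_le (R : realType) (dO : measure_display)
    (Omega : measurableType dO) (P : probability Omega R) (p : nat)
    (X : Omega -> 'cV[R]_p) (A B : set 'cV[R]_p) :
  random_vector X -> borel A -> borel B -> A `<=` B ->
  region_prob P X A <= region_prob P X B.
Proof.
move=> hX bA bB AB; apply: fine_le; try exact/fin_num_measure/hX.
by apply: le_measure; rewrite ?inE; [exact: hX|exact: hX|move=> w /AB].
Qed.

Lemma borelU (R : realType) (n : nat) (A B : set 'cV[R]_n) :
  borel A -> borel B -> borel (A `|` B).
Proof.
move=> bA bB.
exact: (@measurableU _ (g_sigma_algebraType [set U : set 'cV[R]_n | open U])).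
Qed.

Lemma inf_compact_minimizer_le (R : realType) (n : nat) (B : R) (f0 f1 : 'cV[R]_n -> R) t z :
  inf_compact B f0 f1 -> 0 <= t <= 1 -> is_minimizer (interpolate f0 f1 t) z -> `|z| <= B.
Proof.
move=> [alpha hB] t01 mz; have [[y hy] bnd] := hB t t01.
by apply: le_trans (norm_le_l2norm _) _; apply: bnd; exact: le_trans (mz y) hy.
Qed.

Lemma tcd_continuous (R : realType) (n : nat) (f : 'cV[R]_n -> R) :
  twice_continuously_differentiable f -> continuous (f : _ -> R^o).
Proof. by move=> [df _ _] z; exact: differentiable_continuous. Qed.

Unset Implicit Arguments.

Theorem theorem3 (R : realType) (dO : measure_display)
  (Omega : measurableType dO) (P : probability Omega R)
  (p d : nat) (YT : Type)
  (c : 'cV[R]_d -> YT -> R) (X : Omega -> 'cV[R]_p) (Y : Omega -> YT)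
  (hX : random_vector X)
  (hc : forall z, P.-integrable setT (fun w => (c z (Y w))%:E))
  (* the regions vary along an arbitrary filter, along which D_0 -> 0 *)
  (I : Type) (F : filter_on I)
  (R0 R1 R2 : I -> set 'cV[R]_p)
  (hR1 : forall i, borel (R1 i)) (hR2 : forall i, borel (R2 i))
  (hU : forall i, R0 i = R1 i `|` R2 i)
  (hI : forall i, R1 i `&` R2 i = set0)
  (hp1 : forall i, 0 < region_prob P X (R1 i))
  (hp2 : forall i, 0 < region_prob P X (R2 i))
  (hbounded : exists M : R, forall i x, R0 i x -> l2norm x <= M)
  (* condition 1 *)
  (h1_0 : forall i, twice_continuously_differentiable (cond_cost P c X Y (R0 i)))
  (h1_1 : forall i, twice_continuously_differentiable (cond_cost P c X Y (R1 i)))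
  (h1_2 : forall i, twice_continuously_differentiable (cond_cost P c X Y (R2 i)))
  (* condition 2, with a bound that does not depend on the region *)
  (h2 : exists B : R, forall i,
    inf_compact B (cond_cost P c X Y (R0 i)) (cond_cost P c X Y (R1 i)) /\
    inf_compact B (cond_cost P c X Y (R0 i)) (cond_cost P c X Y (R2 i)))
  (* condition 3 *)
  (h3_1 : forall i, unique_nondegenerate_minimizers
    (cond_cost P c X Y (R0 i)) (cond_cost P c X Y (R1 i)))
  (h3_2 : forall i, unique_nondegenerate_minimizers
    (cond_cost P c X Y (R0 i)) (cond_cost P c X Y (R2 i)))
  (z0 : I -> 'cV[R]_d)
  (hz0 : forall i, is_minimizer (cond_cost P c X Y (R0 i)) (z0 i))
  (* positive definiteness at z0 does not degenerate as the region shrinks *)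
  (h3_unif : exists2 lam : R, 0 < lam & forall i v,
    lam * l2norm v ^+ 2 <= quadform (hess (cond_cost P c X Y (R0 i)) (z0 i)) v)
  (* condition 4 *)
  (m : 'cV[R]_d -> 'cV[R]_p -> R)
  (hm : is_cond_cost_given_X P c X Y m)
  (h4 : twice_lipschitz_differentiable_in_x m)
  (h4_z : twice_differentiable_in_z m)
  (hD : (fun i => diameter (R0 i)) @ F --> (0 : R)) :
  (fun i => `|criterion_oracle P c X Y (R1 i) (R2 i) -
              criterion_apx_soln P c X Y (R1 i) (R2 i) (z0 i)| : R^o)
    =o_F (fun i => diameter (R0 i) ^+ 2 : R^o).
Proof.
have [B hB] := h2; have [M hM] := hbounded; have [lam lam0 hlam] := h3_unif.
(* In Euclidean norm, d (B + 1) covers the points z + h e_l with z in the ball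
   of radius B of the max norm and h <= 1. *)
have [C2x Lip] := h4; have [L hL] := Lip (d%:R * (B + 1)).
have [C2z cH] := h4_z.
apply/eqoP => e e0.
have [rho rho0 gap] := @region_gap R d p m (fun z => grad (m z)) (fun z => hess (m z))
  (fun x => grad (m ^~ x)) (fun x => hess (m ^~ x)) L B M lam (e / 2)
  (fun z => jet2_grad_hess (C2x z)) (fun x => jet2_grad_hess (C2z x))
  (fun z => tcd_continuous (C2x z)) cH hL lam0 (divr_gt0 e0 (ltr0n _ 2)).
have near_D : \forall i \near F, diameter (R0 i) < rho.
  exact: (cvgr_lt _ hD _ rho0).
apply: filterS near_D => i Di.
have subregion A (bA : borel A) (pA : 0 < region_prob P X A) (AR0 : A `<=` R0 i) :
  twice_continuously_differentiable (cond_cost P c X Y A) ->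
  inf_compact B (cond_cost P c X Y (R0 i)) (cond_cost P c X Y A) ->
  unique_nondegenerate_minimizers (cond_cost P c X Y (R0 i)) (cond_cost P c X Y A) ->
  0 <= apx_soln_term P c X Y (R0 i) A (z0 i) - oracle_term P c X Y A <=
    e / 2 * diameter (R0 i) ^+ 2.
  move=> C2A icA unA.
  have t1 : 0 <= (1 : R) <= 1 by rewrite ler01 lexx.
  have [z1 [[m1 _] _]] := unA 1 t1; rewrite interpolate1 in m1.
  rewrite (oracle_termE pA m1) /apx_soln_term -mulrBr.
  have bR0 : borel (R0 i) by rewrite hU; exact: borelU.
  have pR0 : 0 < region_prob P X (R0 i).
    by apply: lt_le_trans pA _; exact: region_prob_le.
  have R0M x : R0 i x -> `|x| <= M by move=> R0x; apply: le_trans (norm_le_l2norm _) (hM i x R0x).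
  have R0D x x' : R0 i x -> R0 i x' -> `|x - x'| <= diameter (R0 i).
    move=> R0x R0x'; apply: le_trans (norm_le_l2norm _) _.
    exact: l2norm_le_diameter (hM i) R0x R0x'.
  have lamH v : lam * `|v| ^+ 2 <= quadform (hess (cond_cost P c X Y (R0 i)) (z0 i)) v.
    apply: le_trans (hlam i v); rewrite ler_pM2l// ler_sqr ?nnegrE ?l2norm_ge0//.
    exact: norm_le_l2norm.
  have uniq (t : R) : 0 <= t <= 1 ->
      exists z, is_unique_minimizer
        (interpolate (cond_cost P c X Y (R0 i)) (cond_cost P c X Y A) t) z.
    by move=> /unA[z [uz _]]; exists z.
  have step := gap (R0 i) A (cond_cost P c X Y (R0 i)) (grad (cond_cost P c X Y (R0 i)))
    (hess (cond_cost P c X Y (R0 i))) (cond_cost P c X Y A) (grad (cond_cost P c X Y A))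
    (hess (cond_cost P c X Y A)) (z0 i) z1 (diameter (R0 i)) AR0 R0M R0D Di
    (cond_cost_is_mean hX hm bR0 pR0) (cond_cost_is_mean hX hm bA pA)
    (jet2_grad_hess (h1_0 i)) (jet2_grad_hess C2A)
    (tcd_continuous (h1_0 i)) (tcd_continuous C2A) lamH uniq
    (fun t z t01 mz => inf_compact_minimizer_le icA t01 mz) (hz0 i) m1.
  have gap0 := m1 (z0 i - invmx (hess (cond_cost P c X Y (R0 i)) (z0 i)) *m
    grad (cond_cost P c X Y A) (z0 i)).
  rewrite mulr_ge0 ?subr_ge0 ?(ltW pA)//=; apply: le_trans step.
  by rewrite ler_piMl ?subr_ge0// region_prob_le1.
have R1R0 : R1 i `<=` R0 i by rewrite hU; exact: subsetUl.
have R2R0 : R2 i `<=` R0 i by rewrite hU; exact: subsetUr.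
have [B1 B2] := hB i.
have /andP[lo1 up1] := subregion _ (hR1 i) (hp1 i) R1R0 (h1_1 i) B1 (h3_1 i).
have /andP[lo2 up2] := subregion _ (hR2 i) (hp2 i) R2R0 (h1_2 i) B2 (h3_2 i).
rewrite /criterion_oracle /criterion_apx_soln -hU /=.
rewrite normr_id (ger0_norm (sqr_ge0 _)) ler_norml; apply/andP; split; lra.
Qed.
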